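(* Let $\mathbf{X}$ be a Hausdorff locally convex space, $Z\in\mathcal{Z}_{\mathbf{X}}$ and $t>0$. Assume that the function $F\in\mathcal{F}_{\mathbf{X}}$ satisfies: (i) $\mathcal{D}(F'_{ef}(0))\supset\mathcal{D}(Z)$ and $F'_{ef}(0)g=Zg$ for $g\in\mathcal{D}(Z)$; (ii) $\mathcal{D}({F^*}'(0))$ is *-dense in $\mathbf{X}^*$. Let $l>0$ and $h\in\mathcal{D}(Z)$. Then the local solution $f:[0,l)\to\mathbf{X}$ of the system $$f'(v)=\overline{Z}f(v),\ v\in[0,l),\qquad f(0)=h,$$ exists on the semi-interval $[0,l)$ if and only if the following conditions are satisfied: (a) for any $s\in[0,l)$, every subsequence of the sequence $\{F(\tfrac tn)^{[ns/t]}h\}_{n\in\mathbb{N}}$ has a weakly convergent subsequence; (b) for any $s\in[0,l)$ there exists a sequence $\{f_n^s\}_{n=1}^\infty$, $f_n^s\in\mathcal{D}(\overline{Z})$, such that $w\text{-}\lim_{n\to\infty}\left(F(\tfrac tn)^{[ns/t]}h-f_n^s\right)=0$ and every subsequence of the sequence $\{\overline{Z}f_n^s\}_{n\in\mathbb{N}}$ has a weakly convergent subsequence. Moreover, if conditions (a)–(b) are satisfied, then $f(v)=\lim_{n\to\infty}F(v/n)^nh$ for $v\in[0,l)$.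
   Context: $\mathbf{X}$ is over $\mathbb{T}\in\{\mathbb{R},\mathbb{C}\}$ with topology generated by semi-norms $\|\cdot\|_\alpha$, $\alpha\in\Omega$. $\mathcal{L}(\mathbf{X})$ is the space of bounded linear operators in $\mathbf{X}$ with the topology of pointwise convergence; $I$ is the identity; $\mathcal{D}(C)$ is the domain of $C$; $[\cdot]$ is the integer part; $w\text{-}\lim$ is the limit in the weak topology $\sigma(\mathbf{X},\mathbf{X}^* )$. A family $G_\beta\in\mathcal{L}(\mathbf{X})$, $\beta\in\Gamma$, is equicontinuous if for any $\alpha\in\Omega$ there are finitely many $\alpha_1,\dots,\alpha_n\in\Omega$ and $b_1,\dots,b_n>0$ with $\sup_\beta\|G_\beta x\|_\alpha\le\sum_i b_i\|x\|_{\alpha_i}$ for all $x\in\mathbf{X}$. For $F:[0,\infty)\to\mathcal{L}(\mathbf{X})$ and $s\ge0$ put $\mathbf{B}^F_s=\{F(\tfrac dn)^m : md/n\le s,\ n,m\in\mathbb{N},\ d\ge0\}$. $\mathcal{E}_{\mathbf{X}}$ is the set of $F:[0,\infty)\to\mathcal{L}(\mathbf{X})$ with $F(0)=I$ and $\mathbf{B}^F_s$ equicontinuous for every $s\ge0$. Many-valued effective derivative: $\mathcal{D}(F'_{mef}(0))$ is the set of $f\in\mathbf{X}$ for which there is a family $\{f_s\}_{s\ge0}$ in $\mathbf{X}$ such that $\lim_{h\to0}f_h=f$ and $\lim_{h\to0}h^{-1}(F(h)-F(0))f_h$ exists (limits as $h\to 0$, $h>0$); $F'_{mef}(0)f$ is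 the set of all $g\in\mathbf{X}$ arising as the second limit for some such family. $\mathcal{F}_{\mathbf{X}}$ is the set of $F\in\mathcal{E}_{\mathbf{X}}$ with $\mathcal{D}(F'_{mef}(0))$ dense in $\mathbf{X}$. For $F\in\mathcal{F}_{\mathbf{X}}$ each $F'_{mef}(0)f$ consists of one element, and the effective derivative $F'_{ef}(0):\mathcal{D}(F'_{mef}(0))\to\mathbf{X}$ is the linear map with $F'_{ef}(0)f\in F'_{mef}(0)f$. $\mathcal{Z}_{\mathbf{X}}$ is the set of all densely defined linear operators $Z$ in $\mathbf{X}$ for which there is $F\in\mathcal{F}_{\mathbf{X}}$ with $\mathcal{D}(Z)\subset\mathcal{D}(F'_{mef}(0))$ and $Zf\in F'_{mef}(0)f$ for all $f\in\mathcal{D}(Z)$; every such $Z$ is closable (the closure of its graph in $\mathbf{X}\times\mathbf{X}$ is the graph of a linear operator, denoted $\overline{Z}$). $\mathbf{X}^*$ is the space of continuous linear functionals with the strong topology (semi-norms $f\mapsto\sup_{x\in A}|f(x)|$, $A\subset\mathbf{X}$ bounded). $F^*(s)=(F(s))^*$. The strong derivative at $0$ of $S:[0,\infty)\to\mathcal{L}(\mathbf{E})$ is $S'(0)\psi=\lim_{h\to0}h^{-1}(S(h)\psi-S(0)\psi)$ with domain $\mathcal{D}(S'(0))$ the set of $\psi\in\mathbf{E}$ for which the limit exists; here it is applied with $\mathbf{E}=\mathbf{X}^*$, $S=F^*$. A set $A\subset\mathbf{X}^*$ is *-dense in $\mathbf{X}^*$ if for each $\phi\in\mathbf{X}^*$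 there is a sequence $\phi_k\in A$ with $\lim_k\phi_k(x)=\phi(x)$ for each $x$ in the completion $\tilde{\mathbf{X}}$ of $\mathbf{X}$. A function $g:[0,l)\to\mathbf{X}$, $l>0$, is a local solution of $f'=\overline{Z}f$ on $[0,l)$, $f(0)=h\in\mathcal{D}(\overline{Z})$, if $g(s)\in\mathcal{D}(\overline{Z})$ for all $s\in[0,l)$, $g(0)=h$, and $g'(s)=\overline{Z}g(s)$ for all $s\in[0,l)$ (one-sided derivative at $0$). *)

(* Defs.v *)
From HB Require Import structures.
From mathcomp Require Import all_boot all_order all_algebra.
From mathcomp Require Import complex.
From mathcomp Require Import all_classical all_reals all_analysis.

Set Implicit Arguments.
Unset Strict Implicit.
Unset Printing Implicit Defensive.

Import Order.TTheory GRing.Theory Num.Theory.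
Import numFieldNormedType.Exports.

Local Open Scope classical_set_scope.
Local Open Scope ring_scope.

(* The scalar field T in {R, C}: C when [cplx] holds, R otherwise. *)
Definition scalars (R : realType) (cplx : bool) : numFieldType :=
  if cplx then (R[i] : numFieldType) else (R : numFieldType).

Definition real_scalar (R : realType) (cplx : bool) : R -> scalars R cplx :=
  match cplx return R -> scalars R cplx with
  | true => fun x => (x%:C)%C
  | false => fun x => x
  end.

(* A partially defined operator; only the values of [app] on [dom] matter. *)
Record operator (X : Type) := Operator { dom : set X ; app :> X -> X }.

(* The sequence F(t/n)^[ns/t] h, n >= 1: its term of index n.+1 is the value at
   [n] of the Rocq sequence. *)
Definition chernoff_iterates (R : realType) (X : Type) (F : R -> X -> X)
    (t s : R) (h : X) : nat -> X :=
  fun n => iter (Num.truncn (n.+1%:R * s / t)) (F (t / n.+1%:R)) h.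

Definition increasing_index (k : nat -> nat) : Prop :=
  {homo k : m n / (m < n)%N}.

Section LocallyConvex.
Context (R : realType) (cplx : bool).
Local Notation K := (scalars R cplx).
Local Notation "r %:K" := (@real_scalar R cplx r) (at level 2).
Context (X : tvsType K).
Implicit Types (F : R -> X -> X) (Z : operator X) (phi psi chi : X -> K).

(** Semi-norms.  As MathComp norms, they take their values in the nonnegative
    elements of [K], which are real numbers also when [K] is complex. *)

Definition is_seminorm (q : X -> K) : Prop :=
  [/\ forall x, 0 <= q x,
      forall x y, q (x + y) <= q x + q y
    & forall (a : K) x, q (a *: x) = `|a| * q x].

Section Seminorms.
Context (Omega : Type) (p : Omega -> X -> K).

Definition generating_seminorms : Prop :=
  (forall alpha, is_seminorm (p alpha)) /\
  forall V : set X, nbhs 0 V <->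
    exists n (alpha : 'I_n -> Omega) (e : K),
      0 < e /\ [set x | forall i, p (alpha i) x < e] `<=` V.

Definition bounded_sets : set (set X) :=
  [set A | forall alpha, exists M : K, forall x, A x -> p alpha x <= M].

Definition bounded_operator (G : X -> X) : Prop :=
  linear G /\ forall A, bounded_sets A -> bounded_sets (G @` A).

Definition equicontinuous_family (B : set (X -> X)) : Prop :=
  forall alpha, exists n (al : 'I_n -> Omega) (b : 'I_n -> K),
    (forall i, 0 < b i) /\
    forall G, B G -> forall x, p alpha (G x) <= \sum_(i < n) b i * p (al i) x.

(** Functions on [0, oo) are total functions on [R] whose values at negative
    arguments are never used. *)

Definition power_family F (s : R) : set (X -> X) :=
  [set G | exists n m (d : R),
    [/\ (0 < n)%N, (0 < m)%N, 0 <= d, m%:R * d / n%:R <= s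
      & G = iter m (F (d / n%:R))]].

Definition class_E F : Prop :=
  [/\ forall s, 0 <= s -> bounded_operator (F s),
      F 0 = id
    & forall s, 0 <= s -> equicontinuous_family (power_family F s)].

Definition mef F (f : X) : set X :=
  [set g | exists f_ : R -> X,
    f_ h @[h --> 0^'+] --> f /\
    ((h^-1)%:K *: (F h (f_ h) - F 0 (f_ h))) @[h --> 0^'+] --> g].

Definition dom_mef F : set X := [set f | mef F f !=set0].

Definition class_F F : Prop := class_E F /\ dense (dom_mef F).

(* For F in the class F_X the set [mef F f] is a singleton on the domain. *)
Definition effective_derivative F : operator X :=
  Operator (dom_mef F) (fun f => xget 0 (mef F f)).

Definition linear_operator Z : Prop :=
  dom Z 0 /\
  forall (a : K) x y, dom Z x -> dom Z y ->
    dom Z (a *: x + y) /\ Z (a *: x + y) = a *: Z x + Z y.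

Definition class_Z Z : Prop :=
  [/\ linear_operator Z, dense (dom Z)
    & exists F, [/\ class_F F, dom Z `<=` dom_mef F
                  & forall f, dom Z f -> mef F f (Z f)]].

Definition op_graph Z : set (X * X) := [set fg | dom Z fg.1 /\ fg.2 = Z fg.1].

(* The operator whose graph is the closure of the graph of Z, for closable Z. *)
Definition closure_operator Z : operator X :=
  Operator [set f | exists g, closure (op_graph Z) (f, g)]
           (fun f => xget 0 [set g | closure (op_graph Z) (f, g)]).

(* The difference quotient is taken at increments d != 0 with s + d in [0, l),
   so that the derivative at s = 0 is one-sided. *)
Definition local_solution Z (l : R) (h : X) (f : R -> X) : Prop :=
  [/\ forall s, 0 <= s < l -> dom (closure_operator Z) (f s),
      f 0 = h
    & forall s, 0 <= s < l ->
        ((d^-1)%:K *: (f (s + d) - f s))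
          @[d --> within [set d | 0 <= s + d < l] 0^']
        --> closure_operator Z (f s)].

Definition dual_space : set (X -> K) :=
  [set phi : X -> K | scalar phi /\ continuous phi].

(* sigma(X, X^* ): the coarsest topology on X making x |-> (phi x)_phi
   continuous into the product of copies of K indexed by the dual space. *)
Definition weak_space : Type :=
  initial_topology
    ((fun x => (fun phi : dual_space => \val phi x))
       : X -> {ptws dual_space -> K}).

Definition weak_cvg (u : nat -> X) (x : X) : Prop :=
  (u : nat -> weak_space) @ \oo --> (x : weak_space).

Definition subsequences_weakly_cvg (u : nat -> X) : Prop :=
  forall k, increasing_index k ->
    exists k', increasing_index k' /\ exists x, weak_cvg (u \o k \o k') x.

Definition adjoint_family F : R -> (X -> K) -> (X -> K) :=
  fun s psi => psi \o F s.

(* The strong topology of the dual is that of uniform convergence on the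
   bounded subsets of X. *)
Definition dom_adjoint_derivative F : set (X -> K) :=
  [set psi : X -> K | dual_space psi /\ exists2 chi, dual_space chi &
    {family bounded_sets,
      (fun x =>
         (h^-1)%:K * (adjoint_family F h psi x - adjoint_family F 0 psi x))
        @[h --> 0^'+] --> chi}].

(** The completion of X, as the set of its minimal Cauchy filters.  Cauchy
    filters are stated through differences because the uniformity carried by
    [tvsType] need not be the translation-invariant one. *)

Definition cauchy_filter (G : set_system X) : Prop :=
  (fun xy : X * X => xy.1 - xy.2) @ (G, G) --> (0 : X).

Definition completion : set (set_system X) :=
  [set G | [/\ ProperFilter G, cauchy_filter G
    & forall H : set_system X,
        ProperFilter H -> cauchy_filter H -> H `<=` G -> G `<=` H]].

(* The continuous extension of phi to the completion. *)
Definition completion_extension phi (G : set_system X) : K := lim (phi @ G).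

Definition star_dense (A : set (X -> K)) : Prop :=
  forall phi, dual_space phi -> exists phi_ : nat -> X -> K,
    (forall k, A (phi_ k)) /\
    forall G, completion G ->
      completion_extension (phi_ k) G @[k --> \oo]
        --> completion_extension phi G.

End Seminorms.
End LocallyConvex.

(* Main.v *)
Require Import Defs.
From HB Require Import structures.
From mathcomp Require Import all_boot all_order all_algebra.
From mathcomp Require Import complex.
From mathcomp Require Import all_classical all_reals all_analysis.
From mathcomp Require Import ring lra.

Set Implicit Arguments.
Unset Strict Implicit.
Unset Printing Implicit Defensive.

Import Order.TTheory GRing.Theory Num.Theory.
Import numFieldNormedType.Exports.

Local Open Scope classical_set_scope.
Local Open Scope ring_scope.

(** A Chernoff-type argument.  If [(x, y)] is in the closure of the graph of [Z],
    then [F(tau)^m x - x] is close to [m tau y] for small [tau] and [m tau], by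
    equicontinuity of the powers and strong continuity of [F(tau)^j] at
    [j tau -> 0].  Telescoping this estimate along a local solution f, by real
    induction on [0, s], gives [F(tau)^[s/tau] h -> f s] without any continuity
    of f'; then (a) and (b) hold with [f_n = f s].

    Conversely, the iterates are equicontinuous in s, so that a diagonal
    subsequence converges weakly, for all s at once, to some [f s], which lies in
    the domain of the closure by (b) and Mazur's lemma.  The difference quotients
    of f at s are Cauchy, since those of the iterates are close to
    [F(tau)^[s/tau] Z h], and functionals in the domain of the derivative of the
    adjoint send them to the values wanted for [closure Z (f s)].  The limit of
    the quotients lives a priori in the completion of X only; *-density
    identifies it with [closure Z (f s)].

    Weak limits are controlled through the Hahn-Banach theorem, whose linear
    functional is obtained as a minimal sublinear functional. *)

(** The derivative of [F] at 0 is attained only along vectors tending to [x], not at [x] itself.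
    Replacing [x] by such a vector, like rounding a time to a multiple of the step, costs an error
    that does not shrink with the elapsed time. The expansions of iterates therefore have the shape
    [e * time + c]: the admissible times depend on [e] alone, and [c] becomes arbitrarily small once
    the step is small. So the step tends to 0 before the time increment does, and [c] may be taken
    proportional to an increment already fixed. The *-density is used with care for a similar
    reason: a functional is only a pointwise limit of good ones, without uniformity, so that limit
    cannot be exchanged with the one of the difference quotients. The Cauchy property repairs this.
    It turns the quotients into a point of the completion, where the pointwise convergence is also
    assumed, so that the two limits are compared at a single point. It also upgrades the resulting
    weak convergence to convergence in X. *)

Section Scalars.
Context (R : realType) (cplx : bool).
Local Notation K := (scalars R cplx).
Local Notation "r %:K" := (@real_scalar R cplx r) (at level 2).

Definition re_part : K -> R :=
  match cplx return scalars R cplx -> R with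
  | true => fun z => complex.Re z
  | false => fun z => z
  end.

(** The norm of [K] takes values in [K]; a real-valued copy lets real and complex scalars share the
    same real inequalities. *)
Definition modulus (z : K) : R := re_part `|z|.

Lemma real_scalarD r s : (r + s)%:K = r%:K + s%:K.
Proof.
rewrite /real_scalar; case: cplx => //=.
by apply/eqP; rewrite eq_complex /= addr0 !eqxx.
Qed.

Lemma real_scalarM r s : (r * s)%:K = r%:K * s%:K.
Proof.
rewrite /real_scalar; case: cplx => //=.
by apply/eqP; rewrite eq_complex /= !(mulr0, mul0r, subr0, addr0) !eqxx.
Qed.

Lemma real_scalar1 : 1%:K = 1.
Proof. by rewrite /real_scalar; case: cplx. Qed.

Lemma real_scalar0 : 0%:K = 0.
Proof. by rewrite /real_scalar; case: cplx. Qed.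

Lemma real_scalarN r : (- r)%:K = - r%:K.
Proof. by apply/eqP; rewrite -addr_eq0 -real_scalarD addNr real_scalar0. Qed.

Lemma real_scalarK r : re_part r%:K = r.
Proof. by rewrite /re_part /real_scalar; case: cplx. Qed.

Lemma ler_real_scalar r s : (r%:K <= s%:K) = (r <= s).
Proof. by rewrite /real_scalar; case: cplx => //=; rewrite lecR. Qed.

Lemma ltr_real_scalar r s : (r%:K < s%:K) = (r < s).
Proof. by rewrite /real_scalar; case: cplx => //=; rewrite ltcR. Qed.

Lemma re_partK z : 0 <= z -> (re_part z)%:K = z.
Proof.
rewrite /re_part /real_scalar; move: z; rewrite /scalars.
case: cplx => //= -[a b]; rewrite lecE /= => /andP[/eqP -> _].
by apply/eqP; rewrite eq_complex /= !eqxx.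
Qed.

Lemma re_partD z w : re_part (z + w) = re_part z + re_part w.
Proof. by rewrite /re_part; move: z w; rewrite /scalars; case: cplx => //= -[a b] [c d]. Qed.

Lemma modulusK z : (modulus z)%:K = `|z|.
Proof. by rewrite /modulus re_partK. Qed.

Lemma modulus_ge0 z : 0 <= modulus z.
Proof. by rewrite -ler_real_scalar modulusK real_scalar0. Qed.

Lemma modulusD z w : modulus (z + w) <= modulus z + modulus w.
Proof. by rewrite -ler_real_scalar real_scalarD !modulusK ler_normD. Qed.

Lemma modulusM z w : modulus (z * w) = modulus z * modulus w.
Proof. by rewrite -[LHS]real_scalarK modulusK normrM -!modulusK -real_scalarM real_scalarK. Qed.

Lemma modulusN z : modulus (- z) = modulus z.
Proof. by rewrite /modulus normrN. Qed.

Lemma modulus_real r : modulus r%:K = `|r|.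
Proof.
rewrite /modulus /re_part /real_scalar; case: cplx => //=.
apply: (eq_trans (congr1 (@complex.Re R) (normc_def (r%:C)%C))).
by rewrite /= expr0n /= addr0 sqrtr_sqr.
Qed.

Lemma modulus0 : modulus 0 = 0.
Proof. by rewrite -real_scalar0 modulus_real normr0. Qed.

Lemma modulus_eq0 z : modulus z = 0 -> z = 0.
Proof. by move=> z0; apply/eqP; rewrite -normr_eq0 -modulusK z0 real_scalar0. Qed.

Lemma re_part_le_modulus z : re_part z <= modulus z.
Proof.
rewrite /modulus /re_part; move: z; rewrite /scalars; case: cplx => //= z.
  apply: (le_trans (ler_norm _)).
  rewrite -lecR; apply: (le_trans (normc_ge_Re z)).
  exact: lexx.
exact: ler_norm.
Qed.

End Scalars.

(** * The Hahn-Banach theorem *)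

Section HahnBanach.
Context (R : realType) (cplx : bool).
Local Notation K := (scalars R cplx).
Local Notation "r %:K" := (@real_scalar R cplx r) (at level 2).
Context (V : lmodType K).
Implicit Types (q : V -> R).

(** One inequality is enough for homogeneity: applied to [r^-1] it gives the reverse one when
    [r > 0]. *)
Definition sublinear q : Prop :=
  (forall x y, q (x + y) <= q x + q y) /\
  (forall (r : R) x, 0 <= r -> q (r%:K *: x) <= r * q x).

Lemma sublinear0 q : sublinear q -> q 0 = 0.
Proof.
move=> [qD qZ]; apply/eqP; rewrite eq_le; apply/andP; split.
  by have := qZ 0 0 (lexx _); rewrite scaler0 mul0r.
by have := qD 0 0; rewrite addr0; lra.
Qed.

Lemma sublinear_ge_opp q x : sublinear q -> - q (- x) <= q x.
Proof. by move=> qs; have := qs.1 x (- x); rewrite subrr sublinear0//; lra. Qed.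

(* The infimum of [tilt q y x] is sublinear in x and at most [q (x + y) - q y];
   if q is minimal this forces additivity. *)
Definition tilt q (y x : V) : set R :=
  [set q (x + t%:K *: y) - t * q y | t in [set t : R | 0 <= t]].

Lemma tilt_lb q y x : sublinear q -> lbound (tilt q y x) (- q (- x)).
Proof.
move=> [qD qZ] _ [t /= t0 <-].
have := qD (x + t%:K *: y) (- x); rewrite addrAC subrr add0r => h1.
have h2 : t * q y <= q (t%:K *: y).
  have [->|tn0] := eqVneq t 0.
    by rewrite mul0r real_scalar0 scale0r sublinear0//; split.
  have tp : 0 < t by rewrite lt_def tn0.
  have := qZ (t^-1) (t%:K *: y); rewrite invr_ge0 => /(_ t0).
  rewrite scalerA -real_scalarM mulVf// real_scalar1 scale1r => h.
  by rewrite -(ler_pM2l (x := t^-1)) ?invr_gt0// mulrA mulVf// mul1r.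
lra.
Qed.

(** Parameters [t1] for [x1] and [t2] for [x2] combine into [t1 + t2] for the sum, and [t] for [x]
    becomes [r * t] for the multiple by [r]. *)
Lemma tilt_sublinear q y : sublinear q -> sublinear (fun x => inf (tilt q y x)).
Proof.
move=> qs; have [qD qZ] := qs.
have lb x : has_lbound (tilt q y x) by exists (- q (- x)); exact: tilt_lb.
have ne x : tilt q y x !=set0 by exists (q (x + 0%:K *: y) - 0 * q y); exists 0 => /=.
split=> [x1 x2|r x r0].
  rewrite -lerBlDr; apply: lb_le_inf => // _ [t1 /= t10 <-].
  rewrite lerBlDr -lerBlDl; apply: lb_le_inf => // _ [t2 /= t20 <-].
  rewrite lerBlDl.
  have : inf (tilt q y (x1 + x2)) <= q (x1 + x2 + (t1 + t2)%:K *: y) - (t1 + t2) * q y.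
    by apply: ge_inf => //; exists (t1 + t2) => //=; exact: addr_ge0.
  have := qD (x1 + t1%:K *: y) (x2 + t2%:K *: y).
  rewrite real_scalarD scalerDl addrACA; lra.
have [->|rn0] := eqVneq r 0.
  rewrite real_scalar0 scale0r mul0r.
  have : inf (tilt q y 0) <= q (0 + 0%:K *: y) - 0 * q y.
    by apply: ge_inf => //; exists 0 => /=.
  by rewrite real_scalar0 scale0r addr0 sublinear0// mul0r subr0.
have rp : 0 < r by rewrite lt_def rn0.
rewrite -ler_pdivrMl//; apply: lb_le_inf => // _ [t /= t0 <-].
rewrite ler_pdivrMl//.
have : inf (tilt q y (r%:K *: x)) <= q (r%:K *: x + (r * t)%:K *: y) - (r * t) * q y.
  by apply: ge_inf => //; exists (r * t) => //=; exact: mulr_ge0.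
have := qZ r (x + t%:K *: y) r0.
rewrite scalerDr scalerA -real_scalarM; lra.
Qed.

Lemma tilt_le q y x : sublinear q -> inf (tilt q y x) <= q x.
Proof.
move=> qs; apply: ge_inf; first by exists (- q (- x)); exact: tilt_lb.
by exists 0 => //=; rewrite real_scalar0 scale0r addr0 mul0r subr0.
Qed.

Lemma tilt_le1 q y x : sublinear q -> inf (tilt q y x) <= q (x + y) - q y.
Proof.
move=> qs; apply: ge_inf; first by exists (- q (- x)); exact: tilt_lb.
by exists 1; rewrite /= ?ler01// real_scalar1 scale1r mul1r.
Qed.

(** Zorn's lemma for the reversed pointwise order. The infimum of a chain is finite, being at least
    [- p (- x)], and subadditive because of two members of a chain the smaller one can serve at both
    points. *)
Lemma minimal_sublinear p : sublinear p ->
  exists2 q, sublinear q /\ (forall x, q x <= p x) &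
    forall q', sublinear q' -> (forall x, q' x <= q x) -> q' = q.
Proof.
move=> ps.
pose T := {q | sublinear q /\ (forall x, q x <= p x)}.
pose Rel (a b : T) := `[< forall x, sval b x <= sval a x >].
have [||a b| |a amin] := @Zorn T Rel.
- by move=> a; apply/asboolP.
- move=> a b c /asboolP ab /asboolP bc; apply/asboolP => x.
  exact: le_trans (bc x) (ab x).
- case: a b => [a pa] [b pb] /asboolP /= ab /asboolP /= ba; apply: eq_exist.
  by apply/funext => x; apply/eqP; rewrite eq_le ab ba.
- move=> A Atot; have [[a0 Aa0]|A0] := pselect (A !=set0); last first.
    exists (exist _ p (conj ps (fun x => lexx _))) => s As.
    by exfalso; apply: A0; exists s.
  pose B x := [set sval a x | a in A].
  have lb x : has_lbound (B x).
    exists (- p (- x)) => _ [a Aa <-]; case: (svalP a) => as_ ap.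
    by have := sublinear_ge_opp x as_; have := ap (- x); lra.
  have ne x : B x !=set0 by exists (sval a0 x), a0.
  have Ble x a : A a -> inf (B x) <= sval a x.
    by move=> Aa; apply: ge_inf => //; exists a.
  have bs : sublinear (fun x => inf (B x)).
    split=> [x y|r x r0].
      rewrite -lerBlDr; apply: lb_le_inf => // _ [a Aa <-].
      rewrite lerBlDr -lerBlDl; apply: lb_le_inf => // _ [b Ab <-].
      rewrite lerBlDr.
      have [/asboolP ba|/asboolP ab] := Atot _ _ Aa Ab.
        have := Ble (x + y) _ Ab; have := (svalP b).1.1 x y.
        by have := ba x; lra.
      have := Ble (x + y) _ Aa; have := (svalP a).1.1 x y.
      by have := ab y; lra.
    have [->|rn0] := eqVneq r 0.
      rewrite real_scalar0 scale0r mul0r.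
      by have := Ble 0 _ Aa0; rewrite (sublinear0 (svalP a0).1).
    have rp : 0 < r by rewrite lt_def rn0.
    rewrite -ler_pdivrMl//; apply: lb_le_inf => // _ [a Aa <-].
    rewrite ler_pdivrMl//.
    have := Ble (r%:K *: x) _ Aa; have := (svalP a).1.2 r x r0; lra.
  have bp x : inf (B x) <= p x by have := Ble x _ Aa0; have := (svalP a0).2 x; lra.
  exists (exist (fun q => sublinear q /\ forall x, q x <= p x) _ (conj bs bp)).
  move=> s As; apply/asboolP => x /=.
  exact: Ble.
exists (sval a); first by case: (svalP a).
move=> q' q's q'a.
have q'p x : q' x <= p x by have := q'a x; have := (svalP a).2 x; lra.
rewrite -(amin (exist (fun q => sublinear q /\ forall x, q x <= p x) q' (conj q's q'p)))//.
by apply/asboolP.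
Qed.

Lemma minimal_sublinear_linear q : sublinear q ->
  (forall q', sublinear q' -> (forall x, q' x <= q x) -> q' = q) ->
  (forall x y, q (x + y) = q x + q y) /\ (forall (r : R) x, q (r%:K *: x) = r * q x).
Proof.
move=> qs qmin.
have qD x y : q (x + y) = q x + q y.
  apply/eqP; rewrite eq_le qs.1 /=.
  have /qmin : sublinear (fun x => inf (tilt q y x)) by exact: tilt_sublinear.
  move=> /(_ (fun x => tilt_le _ _ qs)) /(congr1 (@^~ x)) /= <-.
  by rewrite -lerBrDr tilt_le1.
have qN x : q (- x) = - q x.
  by apply/eqP; rewrite -addr_eq0 -qD addNr sublinear0.
have qZ (r : R) x : 0 <= r -> q (r%:K *: x) = r * q x.
  move=> r0; apply/eqP; rewrite eq_le qs.2//=.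
  by have := qs.2 r (- x) r0; rewrite scalerN !qN mulrN lerN2.
split=> // r x; have [/qZ//|r0] := leP 0 r.
by rewrite -[r]opprK real_scalarN scaleNr qN qZ ?mulNr// oppr_ge0 ltW.
Qed.

(** Minimality is sought below the tilt of [p] along [x0], not below [p]: at [- x0] this tilt is at
    most [p 0 - p x0], which forces the value at [x0] up to [p x0]. *)
Lemma hahn_banach_real p x0 : sublinear p ->
  exists u : V -> R,
    [/\ forall x y, u (x + y) = u x + u y,
        forall (r : R) x, u (r%:K *: x) = r * u x,
        forall x, u x <= p x & u x0 = p x0].
Proof.
move=> ps.
have [q [qs qp] qmin] := minimal_sublinear (tilt_sublinear x0 ps).
have [qD qZ] := minimal_sublinear_linear qs qmin.
have qlep x : q x <= p x by apply: (le_trans (qp x)); exact: tilt_le.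
exists q; split=> //; apply/eqP; rewrite eq_le qlep /=.
have := le_trans (qp (- x0)) (tilt_le1 x0 (- x0) ps).
rewrite addNr sublinear0// add0r.
have -> : q (- x0) = - q x0.
  by apply/eqP; rewrite -addr_eq0 -qD addNr sublinear0.
by rewrite lerN2.
Qed.

Definition real_seminorm q : Prop :=
  [/\ forall x, 0 <= q x,
      forall x y, q (x + y) <= q x + q y
    & forall (a : K) x, q (a *: x) = modulus a * q x].

Lemma real_seminorm_sublinear q : real_seminorm q -> sublinear q.
Proof.
move=> [q0 qD qZ]; split=> // r x r0.
by rewrite qZ modulus_real ger0_norm.
Qed.

End HahnBanach.

(** In the complex case a linear functional is recovered from its real part [u] by the classical
    formula [u x - i u (i x)]. *)
Lemma scalar_extension (R : realType) (cplx : bool) (V : lmodType (scalars R cplx))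
    (u : V -> R) :
  (forall x y, u (x + y) = u x + u y) ->
  (forall (r : R) x, u (real_scalar cplx r *: x) = r * u x) ->
  exists2 phi : V -> scalars R cplx, scalar phi & forall x, re_part (phi x) = u x.
Proof.
case: cplx V u => V u uD uZ; last first.
  by exists u => // a x y; rewrite uD; congr (_ + _); exact: uZ.
have uN x : u (- x) = - u x.
  by rewrite -scaleN1r -(real_scalar1 R true) -real_scalarN uZ mulN1r.
exists (fun x => (u x +i* (- u ('i *: x)))%C) => // a x y.
case: a => a b.
have key z : u ((a +i* b)%C *: z) = a * u z + b * u ('i%C *: z).
  have -> : (a +i* b)%C = (real_scalar true a + real_scalar true b * 'i%C : scalars R true).
    by apply/eqP; rewrite eq_complex /=; apply/andP; split; apply/eqP; ring.
  by rewrite scalerDl uD -scalerA !uZ.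
have ii z : u ('i%C *: ('i%C *: z)) = - u z.
  by rewrite scalerA -expr2 sqr_i scaleN1r uN.
apply/eqP; rewrite eq_complex /= scalerDr.
rewrite scalerA [_ * (a +i* b)%C]mulrC -scalerA !uD !key ii.
by apply/andP; split; apply/eqP; ring.
Qed.

Lemma unimodular_rotation (R : realType) (cplx : bool) (z : scalars R cplx) :
  exists2 c : scalars R cplx, modulus c = 1 & c * z = `|z|.
Proof.
have [->|z0] := eqVneq z 0.
  by exists 1; rewrite ?mulr0 ?normr0// -(real_scalar1 R) modulus_real normr1.
exists (`|z| / z); last by rewrite divfK.
by rewrite /modulus normrM normfV normr_id mulfV ?normr_eq0// -(real_scalar1 R) real_scalarK.
Qed.

Lemma hahn_banach (R : realType) (cplx : bool) (V : lmodType (scalars R cplx))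
    (q : V -> R) (x0 : V) : real_seminorm q ->
  exists phi : V -> scalars R cplx,
    [/\ scalar phi, forall x, modulus (phi x) <= q x & modulus (phi x0) = q x0].
Proof.
move=> qs; have [u [uD uZ up ux0]] := hahn_banach_real x0 (real_seminorm_sublinear qs).
have [phi phiL phiu] := scalar_extension uD uZ.
have le x : modulus (phi x) <= q x.
  (* Rotating [x] by [c] makes the value of [phi] equal to its modulus, so the bound on real parts
     bounds the modulus; [q] does not see the rotation. *)
  have [c c1 cphi] := unimodular_rotation (phi x).
  have phic : phi (c *: x) = c * phi x.
    have phi0 : phi 0 = 0.
      have := phiL 1 0 0; rewrite scale1r addr0 mul1r => /eqP.
      by rewrite -subr_eq0 opprD addrA subrr sub0r oppr_eq0 => /eqP.
    by have := phiL c x 0; rewrite addr0 phi0 addr0.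
  rewrite /modulus -cphi -phic phiu; apply: (le_trans (up _)).
  by case: qs => _ _ ->; rewrite c1 mul1r.
exists phi; split=> //; apply/eqP; rewrite eq_le le /= -ux0 -phiu.
exact: re_part_le_modulus.
Qed.

(** * Continuous seminorms and weak convergence *)

Section Seminorms.
Context (R : realType) (cplx : bool).
Local Notation K := (scalars R cplx).
Local Notation "r %:K" := (@real_scalar R cplx r) (at level 2).

Lemma cvg_scalarsP (T : Type) (G : set_system T) (u : T -> K) (a : K) : Filter G ->
  u @ G --> a <-> forall e : R, 0 < e -> \forall i \near G, modulus (u i - a) < e.
Proof.
move=> FG; split=> [/cvgrPdistC_lt h e e0|h].
  have := h e%:K; rewrite -(real_scalar0 R cplx) ltr_real_scalar => /(_ e0).
  by apply: filterS => i; rewrite -modulusK ltr_real_scalar.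
apply/cvgrPdistC_lt => e e0; have := re_partK (ltW e0) => ee.
have /h : 0 < re_part e by rewrite -(@ltr_real_scalar R cplx) ee real_scalar0.
by apply: filterS => i; rewrite -(@ltr_real_scalar R cplx) ee modulusK.
Qed.

Section Lmodule.
Context (V : lmodType K).
Implicit Types q : V -> R.

Lemma real_seminorm0 q : real_seminorm q -> q 0 = 0.
Proof. by move=> qs; rewrite (sublinear0 (real_seminorm_sublinear qs)). Qed.

Lemma real_seminormN q x : real_seminorm q -> q (- x) = q x.
Proof.
case=> _ _ qZ; rewrite -scaleN1r qZ -(real_scalar1 R) -real_scalarN modulus_real.
by rewrite normrN normr1 mul1r.
Qed.

Lemma real_seminormZ q (r : R) x : real_seminorm q -> q (r%:K *: x) = `|r| * q x.
Proof. by case=> _ _ ->; rewrite modulus_real. Qed.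

Lemma real_seminormB q x y : real_seminorm q -> q (x - y) <= q x + q y.
Proof. by move=> qs; rewrite -(real_seminormN y qs); case: qs. Qed.

Lemma real_seminormC q x y : real_seminorm q -> q (x - y) = q (y - x).
Proof. by move=> qs; rewrite -opprB real_seminormN. Qed.

Lemma real_seminorm_cst0 : real_seminorm (fun _ : V => 0 : R).
Proof. by split=> *; rewrite ?addr0 ?mulr0. Qed.

Lemma real_seminorm_add q1 q2 : real_seminorm q1 -> real_seminorm q2 ->
  real_seminorm (fun x => q1 x + q2 x).
Proof.
move=> [a1 b1 c1] [a2 b2 c2]; split=> [x|x y|a x].
- exact: addr_ge0.
- by rewrite addrACA lerD.
- by rewrite c1 c2 mulrDr.
Qed.

Lemma real_seminorm_scale (c : R) q : 0 <= c -> real_seminorm q ->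
  real_seminorm (fun x => c * q x).
Proof.
move=> c0 [a1 b1 c1]; split=> [x|x y|a x].
- exact: mulr_ge0.
- by rewrite -mulrDr ler_wpM2l.
- by rewrite c1 mulrCA.
Qed.

Lemma real_seminorm_scalar (phi : V -> K) : scalar phi ->
  real_seminorm (fun x => modulus (phi x)).
Proof.
move=> phiL.
have phi0 : phi 0 = 0.
  have := phiL 1 0 0; rewrite scale1r addr0 mul1r => /eqP.
  by rewrite -subr_eq0 opprD addrA subrr sub0r oppr_eq0 => /eqP.
split=> [x|x y|a x]; first exact: modulus_ge0.
  by have := phiL 1 x y; rewrite scale1r mul1r => ->; exact: modulusD.
by have := phiL a x 0; rewrite !addr0 phi0 addr0 => ->; exact: modulusM.
Qed.

Lemma scalar0 (phi : V -> K) : scalar phi -> phi 0 = 0.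
Proof. by move=> /real_seminorm_scalar/real_seminorm0; exact: modulus_eq0. Qed.

Lemma scalarDE (phi : V -> K) x y : scalar phi -> phi (x + y) = phi x + phi y.
Proof. by move=> phiL; have := phiL 1 x y; rewrite scale1r mul1r. Qed.

Lemma scalarZE (phi : V -> K) a x : scalar phi -> phi (a *: x) = a * phi x.
Proof. by move=> phiL; have := phiL a x 0; rewrite !addr0 scalar0// addr0. Qed.

Lemma scalarNE (phi : V -> K) x : scalar phi -> phi (- x) = - phi x.
Proof. by move=> phiL; rewrite -scaleN1r scalarZE// mulN1r. Qed.

Lemma scalarBE (phi : V -> K) x y : scalar phi -> phi (x - y) = phi x - phi y.
Proof. by move=> phiL; rewrite scalarDE// scalarNE. Qed.

End Lmodule.

Section Topology.
Context (X : tvsType K) (Omega : Type) (p : Omega -> X -> K).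
Context (genp : generating_seminorms p).
Implicit Types (q : X -> R) (phi : X -> K).

(** All continuous seminorms are used instead of the generating family: being stable under sums and
    nonnegative multiples, they replace finitely many indices and a radius by a single seminorm and
    its unit ball. *)
Definition cseminorm q : Prop :=
  real_seminorm q /\ forall e : R, 0 < e -> nbhs (0 : X) [set x | q x < e].

Lemma cseminorm_cst0 : cseminorm (fun _ => 0).
Proof.
split=> [|e e0]; first exact: real_seminorm_cst0.
by apply: filterS filterT => x _.
Qed.

Lemma cseminorm_add q1 q2 : cseminorm q1 -> cseminorm q2 -> cseminorm (fun x => q1 x + q2 x).
Proof.
move=> [s1 n1] [s2 n2]; split=> [|e e0]; first exact: real_seminorm_add.
have e2 : 0 < e / 2 by rewrite divr_gt0.
apply: filterS (filterI (n1 _ e2) (n2 _ e2)) => x [/= h1 h2].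
lra.
Qed.

Lemma cseminorm_scale (c : R) q : 0 <= c -> cseminorm q -> cseminorm (fun x => c * q x).
Proof.
move=> c0 [s n]; split=> [|e e0]; first exact: real_seminorm_scale.
have c1 : 0 < c + 1 by lra.
apply: filterS (n (e / (c + 1)) _); last by rewrite divr_gt0.
move=> x /=; rewrite ltr_pdivlMr// => h; case: s => /(_ x) q0 _ _; lra.
Qed.

Lemma cseminorm_sum n (q : 'I_n -> X -> R) : (forall i, cseminorm (q i)) ->
  cseminorm (fun x => \sum_(i < n) q i x).
Proof.
elim: n q => [|n IH] q qs.
  by under [X in cseminorm X]funext do rewrite big_ord0; exact: cseminorm_cst0.
under [X in cseminorm X]funext do rewrite big_ord_recl.
by apply: cseminorm_add => //; exact: IH.
Qed.

Lemma cseminorm_generating alpha : cseminorm (fun x => re_part (p alpha x)).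
Proof.
have [p0 pD pZ] := genp.1 alpha; have pK x := re_partK (p0 x).
split; first split=> [x|x y|a x].
- by rewrite -(@ler_real_scalar R cplx) pK real_scalar0.
- by rewrite -re_partD -(@ler_real_scalar R cplx) !re_partK// addr_ge0.
- rewrite -[LHS](real_scalarK cplx) pK pZ -modulusK -{1}pK -real_scalarM.
  by rewrite real_scalarK.
move=> e e0; apply/genp.2; exists 1%N, (fun=> alpha), e%:K; split.
  by rewrite -(real_scalar0 R cplx) ltr_real_scalar.
by move=> x /= /(_ ord0) h; rewrite -(@ltr_real_scalar R cplx) pK.
Qed.

Lemma nbhs0_cseminorm (U : set X) : nbhs 0 U ->
  exists2 q, cseminorm q & [set x | q x < 1] `<=` U.
Proof.
move=> /genp.2 [n [al [e [e0 sub]]]].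
have eK := re_partK (ltW e0).
have r0 : 0 < re_part e by rewrite -(@ltr_real_scalar R cplx) eK real_scalar0.
exists (fun x => (re_part e)^-1 * \sum_(i < n) re_part (p (al i) x)).
  apply: cseminorm_scale; first by rewrite invr_ge0 ltW.
  by apply: cseminorm_sum => i; exact: cseminorm_generating.
move=> x /= h; apply: sub => i /=.
have [p0 _ _] := genp.1 (al i); rewrite -(re_partK (p0 x)) -eK ltr_real_scalar.
apply: le_lt_trans (_ : _ <= \sum_(i < n) re_part (p (al i) x)) _; last first.
  by move: h; rewrite ltr_pdivrMl// mulr1.
rewrite (bigD1 i)//= lerDl sumr_ge0// => j _.
by have [[]] := cseminorm_generating (al j).
Qed.

Lemma nbhs_cseminorm (x : X) (U : set X) :
  nbhs x U <-> exists2 q, cseminorm q & [set y | q (y - x) < 1] `<=` U.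
Proof.
split=> [xU|[q [qs qn] sub]].
  have : nbhs 0 [set y | U (x + y)].
    have /= := @nbhsB _ _ U x (- x) xU; rewrite addNr.
    by apply: filterS => _ [y Uy <-] /=; rewrite addrA subrr add0r.
  move=> /nbhs0_cseminorm [q qs sub]; exists q => // y /sub /=.
  by rewrite addrC subrK.
apply: (@filterS _ _ _ (+%R x @` [set y | q y < 1])); last exact/nbhsT/qn.
by move=> _ [y /= y1 <-]; apply: sub => /=; rewrite addrC addKr.
Qed.

Lemma nbhs_ball_cseminorm (x : X) q (e : R) : cseminorm q -> 0 < e ->
  nbhs x [set y | q (y - x) < e].
Proof.
move=> qs e0; apply/nbhs_cseminorm; exists (fun y => e^-1 * q y).
  by apply: cseminorm_scale => //; rewrite invr_ge0 ltW.
by move=> y /=; rewrite ltr_pdivrMl// mulr1.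
Qed.

Lemma cvg_cseminormP (T : Type) (G : set_system T) (u : T -> X) (x : X) : Filter G ->
  u @ G --> x <->
  forall q, cseminorm q -> forall e : R, 0 < e -> \forall i \near G, q (u i - x) < e.
Proof.
move=> FG; split=> [ux q qs e e0|h U /nbhs_cseminorm [q qs sub]].
  exact: (ux _ (nbhs_ball_cseminorm x qs e0)).
by apply: filterS (h q qs 1 ltr01) => i /= /sub.
Qed.

Lemma dual_cseminorm phi : dual_space phi -> cseminorm (fun x => modulus (phi x)).
Proof.
move=> [phiL phic]; split=> [|e e0]; first exact: real_seminorm_scalar.
have /cvg_scalarsP := phic 0; move=> /(_ e e0); rewrite scalar0//.
by apply: filterS => x /=; rewrite subr0.
Qed.

Lemma cseminorm_dual phi q : scalar phi -> cseminorm q ->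
  (forall x, modulus (phi x) <= q x) -> dual_space phi.
Proof.
move=> phiL qs le; split=> // x; apply/cvg_scalarsP => e e0.
apply: filterS (nbhs_ball_cseminorm x qs e0) => y /= h.
by rewrite -scalarBE//; exact: le_lt_trans (le _) h.
Qed.

Lemma dual_norming q x : cseminorm q -> exists phi,
  [/\ dual_space phi, forall y, modulus (phi y) <= q y & modulus (phi x) = q x].
Proof.
move=> qs; have [phi [phiL le eq]] := hahn_banach x qs.1.
by exists phi; split=> //; exact: cseminorm_dual le.
Qed.

(** Continuity bounds [q] by 1 on a finite intersection of balls of radius [r]; rescaling [x] into
    it turns this into a linear bound. The factor 2 in the constant [2 / r] secures strict
    inequalities. *)
Lemma cseminorm_le_generating q : cseminorm q ->
  exists n (al : 'I_n -> Omega) (c : R), 0 <= c /\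
    forall x, q x <= c * \sum_(i < n) re_part (p (al i) x).
Proof.
move=> [qs qn].
have /genp.2 [n [al [e [e0 sub]]]] := qn 1 ltr01.
have eK := re_partK (ltW e0).
have r0 : 0 < re_part e by rewrite -(@ltr_real_scalar R cplx) eK real_scalar0.
set r := re_part e in r0 eK.
exists n, al, (2 / r); split; first by rewrite divr_ge0// ltW.
move=> x; set s := \sum_(i < n) _.
have ps (i : 'I_n) : re_part (p (al i) x) <= s.
  rewrite /s (bigD1 i)//= lerDl sumr_ge0// => j _.
  by have [[]] := cseminorm_generating (al j).
have s0 : 0 <= s by apply: sumr_ge0 => j _; have [[]] := cseminorm_generating (al j).
apply/ler_addgt0Pr => eta eta0.
(* The extra term keeps the divisor positive when [s = 0] and contributes exactly [eta] after
   multiplication by [2 / r]. *)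
pose s' := s + eta * (r / 2).
have s'0 : 0 < s' by rewrite ltr_wpDl// mulr_gt0// divr_gt0.
have : q ((r / 2 / s')%:K *: x) < 1.
  apply: sub => i /=; have [p0 _ pZ] := genp.1 (al i).
  rewrite -(re_partK (p0 _)) -eK ltr_real_scalar.
  have [[_ _ cZ] _] := cseminorm_generating (al i); rewrite cZ modulus_real.
  rewrite ger0_norm ?divr_ge0 ?ltW//.
  have le1 : re_part (p (al i) x) / s' <= 1.
    by rewrite ler_pdivrMr// mul1r (le_trans (ps i))// lerDl mulr_ge0 ?divr_ge0 ?ltW.
  have -> : r / 2 / s' * re_part (p (al i) x) = r / 2 * (re_part (p (al i) x) / s').
    by ring.
  apply: (@le_lt_trans _ _ (r / 2 * 1)); last by lra.
  by rewrite ler_pM2l// divr_gt0.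
have c0 : 0 < r / 2 / s' by rewrite !divr_gt0.
rewrite real_seminormZ// gtr0_norm// mulrAC ltr_pdivrMr// mul1r.
rewrite -ltr_pdivlMl ?divr_gt0// invf_div => /ltW/le_trans; apply.
by rewrite /s' le_eqVlt; apply/orP; left; apply/eqP; field; rewrite gt_eqF.
Qed.

End Topology.
End Seminorms.

Lemma initial_cvgP (S : choiceType) (T : topologicalType) (f : S -> T)
    (G : set_system S) (s : S) : Filter G ->
  G --> (s : initial_topology f) <-> f @ G --> f s.
Proof.
move=> FG; split=> [Gs B nB|Gs A [_ [[B oB <-] /= Bs BA]]].
  by apply: Gs; exact: (@initial_continuous S T f s B).
have /Gs : nbhs (f s) B by exact: open_nbhs_nbhs.
by move=> GB; exact: (@filterS _ G FG _ _ BA GB).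
Qed.

Section Convergence.
Context (R : realType) (cplx : bool).
Local Notation K := (scalars R cplx).
Local Notation "r %:K" := (@real_scalar R cplx r) (at level 2).
Context (X : tvsType K) (Omega : Type) (p : Omega -> X -> K).
Context (genp : generating_seminorms p).
Implicit Types (q : X -> R) (phi : X -> K) (u : nat -> X).

Lemma bounded_setsP (A : set X) : bounded_sets p A <->
  forall q, cseminorm q -> exists M : R, forall x, A x -> q x <= M.
Proof.
split=> [bA q qs|bA alpha].
  have [n [al [c [c0 le]]]] := cseminorm_le_generating genp qs.
  have [M MA] := choice (fun i => bA (al i)).
  exists (c * \sum_(i < n) re_part (M i)) => x Ax.
  apply: (le_trans (le x)); apply: ler_wpM2l => //; apply: ler_sum => i _.
  have [p0 _ _] := genp.1 (al i).
  rewrite -(@ler_real_scalar R cplx) !re_partK//; first exact: MA.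
  exact: le_trans (p0 x) (MA _ _ Ax).
have [M MA] := bA _ (cseminorm_generating genp alpha).
exists M%:K => x Ax; have [p0 _ _] := genp.1 alpha.
by rewrite -(re_partK (p0 x)) ler_real_scalar MA.
Qed.

Lemma hausdorff_cseminorm : hausdorff_space X ->
  forall x : X, (forall q, cseminorm q -> q x = 0) -> x = 0.
Proof.
move=> haus x x0; apply: haus => A B xA /(nbhs_cseminorm genp) [q qs sub].
exists x; split; first exact: nbhs_singleton.
by apply: sub; rewrite /= subr0 x0.
Qed.

Lemma weak_cvgP u (x : X) : weak_cvg u x <->
  forall phi, dual_space phi -> (fun n => phi (u n)) @ \oo --> phi x.
Proof.
pose ev (y : X) : {ptws @dual_space R cplx X -> K} :=
  fun phi : @dual_space R cplx X => \val phi y.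
split=> [ux phi phid|h].
  have evc : (ev \o u) @ \oo --> ev x.
    by move/initial_cvgP : ux.
  move/cvg_sup : evc => /(_ (SigSub (mem_set phid))) /initial_cvgP.
  exact.
apply/(@initial_cvgP X); apply/cvg_sup => -[phi phid]; apply/initial_cvgP.
by apply: h; exact: set_mem.
Qed.

(** Weak lower semicontinuity: a functional dominated by [q] and norming at the limit transfers the
    bound. *)
Lemma weak_cvg_seminorm_le u (x : X) q (c : R) : weak_cvg u x -> cseminorm q ->
  (\forall n \near \oo, q (u n) <= c) -> q x <= c.
Proof.
move=> /weak_cvgP ux qs uc.
have [phi [phid phiq <-]] := dual_norming genp x qs.
apply/ler_addgt0Pr => e e0.
have /cvg_scalarsP /(_ e e0) h := ux _ phid.
have [n [h1 h2]] := filter_ex (filterI uc h).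
have -> : phi x = phi (u n) - (phi (u n) - phi x) by rewrite opprB addrC subrK.
have := modulusD (phi (u n)) (- (phi (u n) - phi x)); rewrite modulusN.
by have := phiq (u n); lra.
Qed.

Lemma cvg_weak_cvg u (x : X) : u @ \oo --> x -> weak_cvg u x.
Proof.
move=> ux; apply/weak_cvgP => phi [_ phic].
exact: (@cvg_comp _ _ _ u phi _ _ _ ux (phic x)).
Qed.

Lemma weak_cvgB u v (x y : X) : weak_cvg u x -> weak_cvg v y ->
  weak_cvg (fun n => u n - v n) (x - y).
Proof.
move=> /weak_cvgP ux /weak_cvgP vy; apply/weak_cvgP => phi phid.
have [phiL _] := phid; rewrite scalarBE//.
under eq_fun do rewrite scalarBE//.
by apply: cvgB; [exact: ux|exact: vy].
Qed.

Lemma weak_cvgZ u (x : X) (a : K) : weak_cvg u x ->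
  weak_cvg (fun n => a *: u n) (a *: x).
Proof.
move=> /weak_cvgP ux; apply/weak_cvgP => phi phid.
have [phiL _] := phid; rewrite scalarZE//.
under eq_fun do rewrite scalarZE//.
by apply: cvgMl_tmp; exact: ux.
Qed.

Lemma weak_cvg_unique u (x y : X) : hausdorff_space X ->
  weak_cvg u x -> weak_cvg u y -> x = y.
Proof.
move=> haus ux uy; apply/eqP; rewrite -subr_eq0; apply/eqP.
apply: hausdorff_cseminorm => // q qs; apply/eqP; rewrite eq_le.
have [[q0 _ _] _] := qs; rewrite q0 andbT.
apply: (weak_cvg_seminorm_le (weak_cvgB ux uy) qs).
by apply: filterS filterT => n _; rewrite subrr real_seminorm0//; case: qs.
Qed.

Lemma increasing_index_cvg k : increasing_index k -> k @ \oo --> \oo.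
Proof.
move=> ik A [N _ NA]; exists N => // n /= Nn; apply: NA => /=.
apply: (leq_trans Nn); elim: n {Nn} => // n IH.
by apply: (leq_ltn_trans IH); apply: ik.
Qed.

Lemma weak_cvg_subseq u (x : X) k : increasing_index k ->
  weak_cvg u x -> weak_cvg (u \o k) x.
Proof.
move=> /increasing_index_cvg ik /weak_cvgP ux; apply/weak_cvgP => phi /ux h.
exact: (cvg_comp _ _ ik h).
Qed.

Lemma cvg_subsequences_weakly_cvg u (x : X) : u @ \oo --> x -> subsequences_weakly_cvg u.
Proof.
move=> /cvg_weak_cvg ux k ik; exists id; split=> //; exists x.
exact: (weak_cvg_subseq ik ux).
Qed.

(** * Linearity and equicontinuity of the powers of F *)

Section Family.
Context (F : R -> X -> X) (EF : class_E p F).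

Lemma class_E_iterD (m : nat) (tau : R) x y : 0 <= tau ->
  iter m (F tau) (x + y) = iter m (F tau) x + iter m (F tau) y.
Proof.
move=> t0; have [L0 _ _] := EF; have [L _] := L0 _ t0.
by elim: m => //= m ->; have := L 1 (iter m (F tau) x) (iter m (F tau) y); rewrite !scale1r.
Qed.

Lemma class_E_iterZ (m : nat) (tau : R) (a : K) x : 0 <= tau ->
  iter m (F tau) (a *: x) = a *: iter m (F tau) x.
Proof.
move=> t0; have [L0 _ _] := EF; have [L _] := L0 _ t0.
have F0 : F tau 0 = 0.
  by have := L (-1) 0 0; rewrite scaleN1r oppr0 addr0 scaleN1r addNr.
by elim: m => //= m ->; have := L a (iter m (F tau) x) 0; rewrite F0 !addr0.
Qed.

Lemma class_E_iterB (m : nat) (tau : R) x y : 0 <= tau ->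
  iter m (F tau) (x - y) = iter m (F tau) x - iter m (F tau) y.
Proof. by move=> t0; rewrite class_E_iterD// -scaleN1r class_E_iterZ// scaleN1r. Qed.

(** Equicontinuity, applied to the members of [power_family] with [n = 1] and [d = tau], repackaged
    so that one continuous seminorm serves all powers up to the time [S]. *)
Lemma class_E_dominating q (S : R) : cseminorm q -> 0 <= S ->
  exists q', [/\ cseminorm q', forall x, q x <= q' x &
    forall (tau : R) (m : nat) x, 0 <= tau -> m%:R * tau <= S ->
      q (iter m (F tau) x) <= q' x].
Proof.
move=> qs S0; have [_ _ /(_ S S0) eq] := EF.
have dom1 alpha : exists2 q', cseminorm q' & forall (tau : R) (m : nat) x,
    (0 < m)%N -> 0 <= tau -> m%:R * tau <= S ->
    re_part (p alpha (iter m (F tau) x)) <= q' x.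
  have [n [al [b [b0 le]]]] := eq alpha.
  have bK i := re_partK (ltW (b0 i)).
  exists (fun x => \sum_(i < n) re_part (b i) * re_part (p (al i) x)).
    apply: cseminorm_sum => i; apply: cseminorm_scale; last exact: cseminorm_generating.
    by rewrite -(@ler_real_scalar R cplx) bK real_scalar0 ltW.
  move=> tau m x m0 t0 mS.
  have /le /(_ x) : power_family F S (iter m (F tau)).
    by exists 1%N, m, tau; split=> //; rewrite ?invr1 ?mulr1 ?divr1.
  have [p0 _ _] := genp.1 alpha.
  rewrite (_ : \sum_(i < n) _ = (\sum_(i < n) re_part (b i) * re_part (p (al i) x))%:K).
    by rewrite -{1}(re_partK (p0 _)) ler_real_scalar.
  rewrite (big_morph _ (@real_scalarD R cplx) (real_scalar0 R cplx)).
  apply: eq_bigr => i _.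
  have [pi0 _ _] := genp.1 (al i).
  by rewrite real_scalarM bK re_partK.
have [n [al [c [c0 le]]]] := cseminorm_le_generating genp qs.
have /choice[Q HQ] : forall i : 'I_n, exists q', cseminorm q' /\ forall (tau : R) (m : nat) x,
    (0 < m)%N -> 0 <= tau -> m%:R * tau <= S ->
    re_part (p (al i) (iter m (F tau) x)) <= q' x.
  by move=> i; have [q' ? ?] := dom1 (al i); exists q'.
have Qs : cseminorm (fun x => c * \sum_(i < n) Q i x).
  by apply: cseminorm_scale => //; apply: cseminorm_sum => i; case: (HQ i).
(* The summand [q x] covers the power [m = 0], absent from [power_family], and makes the new
   seminorm dominate [q]. *)
exists (fun x => q x + c * \sum_(i < n) Q i x); split.
- exact: cseminorm_add.
- by move=> x; rewrite lerDl; have [[]] := Qs.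
- move=> tau [|m] x t0 mS.
    by rewrite lerDl; have [[]] := Qs.
  apply: (le_trans (le _)); rewrite -[leLHS]add0r; apply: lerD.
    by have [[]] := qs.
  by apply: ler_wpM2l => //; apply: ler_sum => i _; apply: (HQ i).2.
Qed.

End Family.
End Convergence.

(** * Powers of F on short time intervals *)

Lemma near_right0P (R : realType) (P : R -> Prop) :
  (\forall h \near 0^'+, P h) <-> exists2 d : R, 0 < d & forall h, 0 < h < d -> P h.
Proof.
split=> [/= [d /= d0 dP]|[d d0 dP]].
  exists d => // h /andP[h0 hd]; apply: dP => //=.
  by rewrite sub0r normrN gtr0_norm.
exists d => //= h /=; rewrite sub0r normrN => hd h0; apply: dP.
by rewrite h0 /=; move: hd; rewrite gtr0_norm.
Qed.

Section Identities.
Context (R : realType) (cplx : bool).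
Local Notation K := (scalars R cplx).
Context (X : tvsType K) (Omega : Type) (p : Omega -> X -> K).
Context (genp : generating_seminorms p) (hausX : hausdorff_space X).

Lemma dual_separates (x y : X) : (forall phi, dual_space phi -> phi x = phi y) -> x = y.
Proof.
move=> h; apply/eqP; rewrite -subr_eq0; apply/eqP.
apply: (hausdorff_cseminorm genp hausX) => q qs.
have [phi [phid _ <-]] := dual_norming genp (x - y) qs.
by rewrite scalarBE ?h ?subrr ?modulus0//; case: phid.
Qed.

Lemma linear_identity (x y : X) : (forall phi : X -> K, scalar phi -> phi x = phi y) -> x = y.
Proof. by move=> h; apply: dual_separates => phi [phiL _]; exact: h. Qed.

End Identities.

(* Equality of two linear combinations of vectors is tested against the
   functionals separating the points of X, where it becomes a ring identity. *)
Ltac linear_identity_tac genp hausX :=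
  apply: (linear_identity genp hausX);
  let phi := fresh "phi" in let phiL := fresh "phiL" in
  intros phi phiL;
  rewrite ?(scalarDE _ _ phiL, scalarNE _ phiL, scalarZE _ _ phiL, scalar0 phiL);
  rewrite ?(real_scalarD, real_scalarN, real_scalarM, real_scalar1, real_scalar0);
  ring.

Section Generator.
Context (R : realType) (cplx : bool).
Local Notation K := (scalars R cplx).
Local Notation "r %:K" := (@real_scalar R cplx r) (at level 2).
Context (X : tvsType K) (Omega : Type) (p : Omega -> X -> K).
Context (genp : generating_seminorms p) (hausX : hausdorff_space X).
Implicit Types (q : X -> R) (x y : X).

Local Ltac vector := linear_identity_tac genp hausX.

Lemma cseminorm_triangle q x y z : cseminorm q -> q (x - z) <= q (x - y) + q (y - z).
Proof. by case=> -[_ qD _] _; have := qD (x - y) (y - z); rewrite addrA subrK. Qed.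

Lemma closure_graphP (Z : operator X) x y : closure (op_graph Z) (x, y) <->
  forall q (e : R), cseminorm q -> 0 < e ->
    exists a, [/\ dom Z a, q (a - x) < e & q (Z a - y) < e].
Proof.
split=> [cl q e qs e0|h A [[B C] [/=]]].
  have [[a b] [[/= da ->] [/= h1 h2]]] : op_graph Z `&`
      ([set a | q (a - x) < e] `*` [set b | q (b - y) < e]) !=set0.
    apply: cl; exists ([set a | q (a - x) < e], [set b | q (b - y) < e]) => //.
    by split; exact: (nbhs_ball_cseminorm genp).
  by exists a.
move=> /(nbhs_cseminorm genp)[q1 q1s sub1] /(nbhs_cseminorm genp)[q2 q2s sub2] BCA.
have [a [da h1 h2]] := h _ 1 (cseminorm_add q1s q2s) ltr01.
have [[q10 _ _] _] := q1s; have [[q20 _ _] _] := q2s.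
exists (a, Z a); split; first by split.
apply: BCA; split => /=.
  by apply: sub1 => /=; apply: le_lt_trans h1; rewrite lerDl.
by apply: sub2 => /=; apply: le_lt_trans h2; rewrite lerDr.
Qed.

Section Family.
Context (F : R -> X -> X) (FF : class_F p F).

(* The relation [mef F x y], with the family f_h allowed to depend on the
   seminorm and the precision; in this form it is stable under closure. *)
Definition approx_derivative x y : Prop :=
  forall q (e : R), cseminorm q -> 0 < e -> exists2 d : R, 0 < d &
    forall tau : R, 0 < tau < d -> exists x',
      q (x' - x) <= e /\ q (F tau x' - x' - tau%:K *: y) <= e * tau.

Lemma mef_approx_derivative x y : mef F x y -> approx_derivative x y.
Proof.
move=> [f_ [/(cvg_cseminormP genp) fx /(cvg_cseminormP genp) fy]] q e qs e0.
have [[_ F0 _] _] := FF.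
have /near_right0P [d d0 dP] : \forall h \near 0^'+, q (f_ h - x) < e /\
    q ((h^-1)%:K *: (F h (f_ h) - F 0 (f_ h)) - y) < e.
  exact: filterI (fx q qs e e0) (fy q qs e e0).
exists d => // tau td; have [/ltW h1 /ltW h2] := dP _ td; exists (f_ tau); split=> //.
have t0 : 0 < tau by case/andP: td.
have -> : F tau (f_ tau) - f_ tau - tau%:K *: y =
    tau%:K *: ((tau^-1)%:K *: (F tau (f_ tau) - F 0 (f_ tau)) - y).
  rewrite scalerBr scalerA -real_scalarM mulfV ?gt_eqF// real_scalar1 scale1r.
  by rewrite F0.
rewrite real_seminormZ; last by case: qs.
by rewrite gtr0_norm// mulrC ler_pM2r.
Qed.

Lemma closure_approx_derivative (Z : operator X) x y :
  (forall f, dom Z f -> mef F f (Z f)) ->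
  closure (op_graph Z) (x, y) -> approx_derivative x y.
Proof.
move=> ZF /closure_graphP cl q e qs e0; have e2 : 0 < e / 2 by rewrite divr_gt0.
have [a [da ax ay]] := cl q (e / 2) qs e2.
have [d d0 dP] := mef_approx_derivative (ZF a da) qs e2.
exists d => // tau td; have [x' [h1 h2]] := dP _ td; exists x'; split.
  by have := cseminorm_triangle x' a x qs; lra.
have t0 : 0 < tau by case/andP: td.
have -> : F tau x' - x' - tau%:K *: y =
  (F tau x' - x' - tau%:K *: Z a) + tau%:K *: (Z a - y) by vector.
have [qn _] := qs; have [_ qD _] := qn; apply: (le_trans (qD _ _)).
rewrite real_seminormZ// gtr0_norm//.
by have : tau * q (Z a - y) <= tau * (e / 2); [rewrite ler_pM2l// ltW|lra].
Qed.

Let EF : class_E p F := FF.1.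

(** Telescoping: [F^m x - x] is the sum of the [F^j (F x - x)] over [j < m]. *)
Lemma iter_increment_le q (tau c : R) (m : nat) x w : cseminorm q -> 0 <= tau ->
  (forall j, (j < m)%N -> q (iter j (F tau) (F tau x - x) - w) <= c) ->
  q (iter m (F tau) x - x - m%:R%:K *: w) <= m%:R * c.
Proof.
move=> qs t0; have [qn _] := qs; have [_ qD _] := qn.
elim: m => [_|m IH h] /=.
  by rewrite subrr real_scalar0 scale0r subr0 real_seminorm0// mul0r.
have -> : F tau (iter m (F tau) x) - x - m.+1%:R%:K *: w =
  (iter m (F tau) x - x - m%:R%:K *: w) + (iter m (F tau) (F tau x - x) - w).
  rewrite (class_E_iterB EF)// -iterSr /= -natr1; vector.
apply: (le_trans (qD _ _)); rewrite -natr1 mulrDl mul1r; apply: lerD.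
  by apply: IH => j jm; apply: h; exact: ltnW.
exact: h.
Qed.

(** By density [x] is close to some [x'], depending on [tau], with [F(tau) x' - x'] of order [tau];
    its [j] increments add up to order [j tau]. Equicontinuity controls the replacement of [x] by
    [x'] uniformly in [j]. *)
Lemma strong_continuity x q (e : R) : cseminorm q -> 0 < e ->
  exists2 d : R, 0 < d & forall (tau : R) (j : nat), 0 < tau < d -> j%:R * tau < d ->
    q (iter j (F tau) x - x) <= e.
Proof.
move=> qs e0; have [_ dens] := FF.
have [q' [q's qq' dom]] := class_E_dominating genp EF qs (ler01 : 0 <= 1 :> R).
have [qn _] := qs; have [q0 _ _] := qn; have [q'n _] := q's; have [q'0 q'D _] := q'n.
have e6 : 0 < e / 6 by lra.
have [x0 [/= x0x [y mefy]]] : [set z | q' (z - x) < e / 6]^° `&` dom_mef F !=set0.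
  apply: dens; last exact: open_interior.
  by exists x; exact: (nbhs_ball_cseminorm genp).
move/interior_subset : x0x => /= x0x.
have [d d0 dP] := mef_approx_derivative mefy q's e6.
have c0 : 0 < q' y + e by rewrite ltr_wpDl.
exists (Num.min (Num.min d 1) (e / 6 / (q' y + e))).
  by rewrite !lt_min d0 ltr01 divr_gt0.
move=> tau j; rewrite !lt_min => /andP[t0 /andP[/andP[td t1] tc]] /andP[/andP[jd j1] jc].
have [x' [h1 h2]] := dP tau (introT andP (conj t0 td)).
have hx : q' (x' - x) <= e / 3 by have := cseminorm_triangle x' x0 x q's; lra.
have incr : q (iter j (F tau) x' - x') <= e / 6.
  have := @iter_increment_le q tau (tau * (q' y + e)) j x' 0 qs (ltW t0).
  rewrite scaler0 subr0 => h; apply: (le_trans (h _)) => [i ij|]; last first.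
    by rewrite mulrA -ler_pdivlMr// ltW.
  rewrite subr0; apply: (le_trans (dom _ _ _ (ltW t0) _)).
    by apply: ltW; apply: le_lt_trans j1; rewrite ler_wpM2r ?(ltW t0)// ler_nat ltnW.
  have := q'D (F tau x' - x' - tau%:K *: y) (tau%:K *: y).
  rewrite subrK real_seminormZ// gtr0_norm//.
  have : 0 <= e * tau by rewrite mulr_ge0 ?(ltW e0) ?(ltW t0).
  lra.
have := cseminorm_triangle (iter j (F tau) x) (iter j (F tau) x') x qs.
have := cseminorm_triangle (iter j (F tau) x') x' x qs.
have := dom tau j (x - x') (ltW t0) (ltW j1).
rewrite (class_E_iterB EF) ?(ltW t0)// real_seminormC//.
rewrite (@real_seminormC _ _ _ q' x)// real_seminormC//.
have := qq' (x' - x); lra.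
Qed.

(** The order of the quantifiers matters: [d] depends on [e] only, [tau0] also on [c]. Each
    telescoped increment of the auxiliary [x'] is [tau y] up to [e tau], by strong continuity at
    [y]; passing from [x] to [x'] costs [c / 2] twice, once directly and once under the power. *)
Lemma iter_expansion x y q (e : R) : approx_derivative x y -> cseminorm q -> 0 < e ->
  exists2 d : R, 0 < d & forall c : R, 0 < c -> exists2 tau0 : R, 0 < tau0 &
    forall (tau : R) (m : nat), 0 < tau < tau0 -> m%:R * tau < d ->
      q (iter m (F tau) x - x - (m%:R * tau)%:K *: y) <= e * (m%:R * tau) + c.
Proof.
move=> xy qs e0; have e2 : 0 < e / 2 by lra.
have [q' [q's qq' dom]] := class_E_dominating genp EF qs (ler01 : 0 <= 1 :> R).
have [d d0 dP] := strong_continuity y qs e2.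
have [qn _] := qs; have [_ qD _] := qn; have [q'n _] := q's.
exists (Num.min d 1); first by rewrite lt_min d0 ltr01.
move=> c c0.
have ec : 0 < Num.min (e / 2) (c / 2) by rewrite lt_min e2; lra.
have [d' d'0 d'P] := xy q' _ q's ec.
exists (Num.min d' d); first by rewrite lt_min d'0 d0.
move=> tau m; rewrite !lt_min => /andP[t0 /andP[td' td]] /andP[md m1].
have [x' [h1 h2]] := d'P tau (introT andP (conj t0 td')).
have {}h1 : q' (x' - x) <= c / 2 by apply: le_trans h1 _; rewrite ge_min lexx orbT.
have {}h2 : q' (F tau x' - x' - tau%:K *: y) <= e / 2 * tau.
  by apply: le_trans h2 _; rewrite ler_pM2r// ge_min lexx.
have main : q (iter m (F tau) x' - x' - (m%:R * tau)%:K *: y) <= e * (m%:R * tau).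
  rewrite real_scalarM -scalerA mulrCA.
  apply: iter_increment_le; [exact: qs|exact: ltW|move=> j jm].
  have jtm : j%:R * tau <= m%:R * tau by rewrite ler_wpM2r ?(ltW t0)// ler_nat ltnW.
  have -> : iter j (F tau) (F tau x' - x') - tau%:K *: y =
    iter j (F tau) (F tau x' - x' - tau%:K *: y) + tau%:K *: (iter j (F tau) y - y).
    rewrite (class_E_iterB EF _ _ (tau%:K *: y)) ?(ltW t0)// (class_E_iterZ EF) ?(ltW t0)//.
    by vector.
  apply: (le_trans (qD _ _)); rewrite real_seminormZ// gtr0_norm//.
  have := dom tau j (F tau x' - x' - tau%:K *: y) (ltW t0) (le_trans jtm (ltW m1)).
  have := dP tau j (introT andP (conj t0 td)) (le_lt_trans jtm md).
  rewrite -(ler_pM2l t0); lra.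
have -> : iter m (F tau) x - x - (m%:R * tau)%:K *: y =
  (iter m (F tau) x' - x' - (m%:R * tau)%:K *: y) +
  ((x' - x) - iter m (F tau) (x' - x)).
  by rewrite (class_E_iterB EF) ?(ltW t0)//; vector.
apply: (le_trans (qD _ _)).
have := real_seminormB (x' - x) (iter m (F tau) (x' - x)) qn.
have := dom tau m (x' - x) (ltW t0) (ltW m1); have := qq' (x' - x); lra.
Qed.

End Family.
End Generator.

(** * Local solutions are limits of iterates *)

Section Increments.
Context (R : realType).
Implicit Types (u tau : R).

Lemma truncn_mul_le u tau : 0 <= u -> 0 < tau -> (Num.truncn (u / tau))%:R * tau <= u.
Proof.
move=> u0 t0; rewrite -ler_pdivlMr//.
by have /andP[] := truncn_itv (divr_ge0 u0 (ltW t0)).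
Qed.

Lemma truncn_mul_gt u tau : 0 <= u -> 0 < tau ->
  u < (Num.truncn (u / tau))%:R * tau + tau.
Proof.
move=> u0 t0; have /andP[_] := truncn_itv (divr_ge0 u0 (ltW t0)).
by rewrite ltr_pdivrMr// -natr1 mulrDl mul1r.
Qed.

Lemma truncn_mulB u v tau : 0 <= u -> u <= v -> 0 < tau ->
  let m := (Num.truncn (v / tau) - Num.truncn (u / tau))%N in
  (Num.truncn (v / tau) = m + Num.truncn (u / tau))%N /\
  `|m%:R * tau - (v - u)| <= tau.
Proof.
move=> u0 uv t0 m; have v0 := le_trans u0 uv.
have le : (Num.truncn (u / tau) <= Num.truncn (v / tau))%N.
  by apply: le_truncn; rewrite ler_pM2r ?invr_gt0.
split; first by rewrite /m subnK.
rewrite /m natrB// mulrBl.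
have := truncn_mul_le u0 t0; have := truncn_mul_gt u0 t0.
have := truncn_mul_le v0 t0; have := truncn_mul_gt v0 t0.
by rewrite ler_norml => *; apply/andP; split; lra.
Qed.

(** The step compares only times on the two sides of [xi], which is what differentiability at the
    single point [xi] controls. Applied at the supremum of the times where [P] holds, it would pass
    beyond that supremum unless it is [T]. *)
Lemma real_induction (P : R -> Prop) (T : R) : 0 <= T -> P 0 ->
  (forall xi, 0 <= xi <= T -> exists2 d : R, 0 < d &
    forall s u, 0 <= s -> s <= xi -> xi <= u -> u <= T -> u - s < d -> P s -> P u) ->
  P T.
Proof.
move=> T0 P0 step; pose A := [set u | 0 <= u <= T /\ P u].
have A0 : A 0 by split; rewrite ?lexx.
have supA : has_sup A by split; [exists 0|exists T => u [/andP[]]].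
have ub u : A u -> u <= sup A by move=> Au; apply: ub_le_sup => //; case: supA.
have sT : sup A <= T by apply: ge_sup; [exists 0|move=> u [/andP[]]].
have [d d0 dP] : exists2 d : R, 0 < d & forall s u, 0 <= s -> s <= sup A ->
    sup A <= u -> u <= T -> u - s < d -> P s -> P u.
  by apply: step; rewrite ub.
have d2 : 0 < d / 2 by rewrite divr_gt0.
have [s As ss] := sup_adherent d2 supA; have [/andP[s0 _] Ps] := As.
(* As [s] is less than [d / 2] below the supremum, [d / 2 + d / 3 < d] keeps the step applicable. *)
pose u := Num.min T (sup A + d / 3).
have Pu : P u.
  apply: (dP s) => //; first exact: ub.
  - by rewrite le_min sT lerDl; lra.
  - by rewrite ge_min lexx.
  - have : u <= sup A + d / 3 by rewrite ge_min lexx orbT.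
    lra.
have : u <= sup A.
  apply/ub; split=> //; rewrite /u ge_min lexx le_min T0 /= andbT.
  by rewrite addr_ge0 ?ub//; lra.
rewrite /u ge_min => /orP[TsA|]; last by lra.
by move: Pu; rewrite /u min_l//; lra.
Qed.

Lemma within_dnbhs0P (A : set R) (P : R -> Prop) :
  (\forall d \near within A 0^', P d) <->
  exists2 r : R, 0 < r & forall d, d != 0 -> `|d| < r -> A d -> P d.
Proof.
split=> [[r /= r0 rP]|[r r0 rP]].
  exists r => // d d0 dr Ad; apply: rP => //=.
  by rewrite sub0r normrN.
by exists r => //= d /=; rewrite sub0r normrN => dr d0 Ad; exact: rP.
Qed.

End Increments.

Section Solution.
Context (R : realType) (cplx : bool).
Local Notation K := (scalars R cplx).
Local Notation "r %:K" := (@real_scalar R cplx r) (at level 2).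
Context (X : tvsType K) (Omega : Type) (p : Omega -> X -> K).
Context (genp : generating_seminorms p) (hausX : hausdorff_space X).
Context (F : R -> X -> X) (FF : class_F p F).
Implicit Types (q : X -> R) (x y : X).

Local Ltac vector := linear_identity_tac genp hausX.
Let EF : class_E p F := FF.1.

Lemma derivative_increment_le (l s : R) (f : R -> X) y q (e : R) :
  ((d^-1)%:K *: (f (s + d) - f s)) @[d --> within [set d | 0 <= s + d < l] 0^'] --> y ->
  cseminorm q -> 0 < e ->
  exists2 r : R, 0 < r & forall d, `|d| < r -> 0 <= s + d < l ->
    q (f (s + d) - f s - d%:K *: y) <= e * `|d|.
Proof.
move=> /(cvg_cseminormP genp) fy qs e0; have [qn _] := qs.
have /within_dnbhs0P [r r0 rP] := fy q qs e e0.
exists r => // d dr ld; have [->|d0] := eqVneq d 0.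
  by rewrite addr0 subrr real_scalar0 scale0r subr0 normr0 mulr0 real_seminorm0.
have /ltW := rP d d0 dr ld.
rewrite -(ler_pM2r (x := `|d|)) ?normr_gt0// => /(le_trans _); apply.
rewrite mulrC -real_seminormZ// scalerBr scalerA -real_scalarM mulfV//.
by rewrite real_scalar1 scale1r.
Qed.

Context (Z : operator X) (ZF : forall g, dom Z g -> mef F g (Z g)).

Lemma closure_operatorP x : dom (closure_operator Z) x ->
  closure (op_graph Z) (x, closure_operator Z x).
Proof. by move=> [y xy]; apply: (@xgetPex _ 0 [set g | closure (op_graph Z) (x, g)]); exists y. Qed.

Lemma solution_iterates_le (l : R) (h : X) (f : R -> X) (T : R) q (e : R) :
  local_solution Z l h f -> 0 <= T < l -> cseminorm q -> 0 < e ->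
  exists2 tau0 : R, 0 < tau0 & forall tau : R, 0 < tau < tau0 ->
    q (iter (Num.truncn (T / tau)) (F tau) h - f T) <= e * T.
Proof.
move=> [fdom f0 fder] /andP[T0 Tl] qs e0.
have [qn _] := qs; have [_ qD _] := qn.
pose k (u tau : R) := Num.truncn (u / tau).
(* The additional power [F(tau)^m] absorbs the change of seminorm caused by
   equicontinuity, so that local errors simply add up. *)
pose P u := exists2 tau0 : R, 0 < tau0 & forall (tau : R) (m : nat), 0 < tau < tau0 ->
  (m + k u tau)%:R * tau <= T ->
  q (iter m (F tau) (iter (k u tau) (F tau) h - f u)) <= e * u.
suff [tau0 t00 H] : P T.
  exists tau0 => // tau ht; have t0 : 0 < tau by case/andP: ht.
  by apply: (H tau 0%N) => //; exact: truncn_mul_le.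
apply: real_induction => //.
  exists 1 => // tau m /andP[t0 _] _; rewrite /k mul0r truncn0 /= f0 mulr0.
  by rewrite (class_E_iterB EF) ?(ltW t0)// subrr real_seminorm0.
move=> xi /andP[xi0 xiT].
have xil : 0 <= xi < l by rewrite xi0 (le_lt_trans xiT).
(* Two enlargements are needed: [q1] absorbs the outer power [m], and [q2] the power [n] that acts
   on the remainder of [f s] about [xi]. *)
have [q1 [q1s qq1 dom1]] := class_E_dominating genp EF qs T0.
have [q2 [q2s q12 dom2]] := class_E_dominating genp EF q1s T0.
have [q1n _] := q1s; have [q10 q1D _] := q1n.
set x := f xi; set y := closure_operator Z x.
have e6 : 0 < e / 6 by lra.
have xy : approx_derivative F x y.
  exact: (closure_approx_derivative genp hausX FF ZF (closure_operatorP (fdom _ xil))).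
have [d1 d10 D1] := iter_expansion genp hausX FF xy q1s e6.
have [d2 d20 D2] := strong_continuity genp hausX FF y q1s e6.
have [d3 d30 D3] := derivative_increment_le (fder _ xil) q2s e6.
pose d := Num.min (Num.min d1 d2) d3.
have d0 : 0 < d by rewrite !lt_min d10 d20 d30.
have [dd1 dd2 dd3] : [/\ d <= d1, d <= d2 & d <= d3].
  by split; rewrite !ge_min lexx ?orbT.
exists (d / 2); first by rewrite divr_gt0.
move=> s u s0 sxi xiu uT usd [tau1 t10 Hs].
have [<-|su] := eqVneq s u; first by exists tau1.
have {su} su : 0 < u - s by rewrite subr_gt0 lt_neqAle su (le_trans sxi).
(* Since [s] and [u] are fixed before [tau], the additive error can be made proportional to [u - s],
   so that it sums up to a multiple of [e]. *)
have c0 : 0 < e / 6 * (u - s) by rewrite mulr_gt0.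
have [tau2 t20 H2] := D1 _ c0.
have den : 0 < e / 6 + q1 y by rewrite ltr_wpDr.
exists (Num.min (Num.min tau1 tau2) (Num.min (d / 2) (e / 6 * (u - s) / (e / 6 + q1 y)))).
  by rewrite !lt_min t10 t20 !divr_gt0.
move=> tau m; rewrite !lt_min => /andP[t0 /andP[/andP[tt1 tt2] /andP[td tc]]] mT.
have [ku mus] := truncn_mulB s0 (le_trans sxi xiu) t0.
set n := (Num.truncn (u / tau) - _)%N in ku mus.
have {mus} /andP[mus1 mus2] : - tau <= n%:R * tau - (u - s) <= tau by rewrite -ler_norml.
have nT : n%:R * tau <= T.
  apply: le_trans mT; rewrite ler_wpM2r ?(ltW t0)// ler_nat.
  by rewrite /k ku addnCA leq_addr.
have mT' : m%:R * tau <= T.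
  by apply: le_trans mT; rewrite ler_wpM2r ?(ltW t0)// ler_nat leq_addr.
have hs : q (iter (m + n) (F tau) (iter (k s tau) (F tau) h - f s)) <= e * s.
  apply: Hs; first by rewrite t0.
  by rewrite -addnA; move: mT; rewrite /k ku.
have hsu : q1 (iter n (F tau) (f s) - f u) <= e * (u - s).
  pose a := xi - s; pose b := u - xi.
  have a0 : 0 <= a by rewrite subr_ge0.
  have b0 : 0 <= b by rewrite subr_ge0.
  have E1 : q2 (f s - x + a%:K *: y) <= e / 6 * a.
    have := D3 (- a); rewrite normrN (ger0_norm a0) /a opprB addrCA subrr addr0.
    have -> : f s - x + (xi - s)%:K *: y = f s - x - (s - xi)%:K *: y by vector.
    apply; first by rewrite /b /a in b0 *; lra.
    by rewrite s0 (le_lt_trans sxi)//; case/andP: xil.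
  have E2 : q2 (f u - x - b%:K *: y) <= e / 6 * b.
    have := D3 b; rewrite (ger0_norm b0) /b addrCA subrr addr0; apply.
      by rewrite /b /a in a0 *; lra.
    by rewrite (le_trans xi0 xiu) (le_lt_trans uT).
  have E3 : q1 (iter n (F tau) x - x - (n%:R * tau)%:K *: y) <=
      e / 6 * (n%:R * tau) + e / 6 * (u - s).
    by apply: H2; rewrite ?t0//; lra.
  have E4 : q1 (iter n (F tau) y - y) <= e / 6.
    by apply: D2; rewrite ?t0/=; lra.
  (* Everything is expanded about [xi]: [f s] is near [x - a y], [f u] near [x + b y] with
     [a + b = u - s], the power [n] takes [x] near [x + n tau y], and it nearly fixes [y]. *)
  have -> : iter n (F tau) (f s) - f u =
      (iter n (F tau) (f s - x + a%:K *: y) - (f u - x - b%:K *: y)) +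
      ((iter n (F tau) x - x - (n%:R * tau)%:K *: y) +
       ((n%:R * tau - (u - s))%:K *: y - a%:K *: (iter n (F tau) y - y))).
    rewrite (class_E_iterD EF) ?(ltW t0)// (class_E_iterB EF) ?(ltW t0)//.
    rewrite (class_E_iterZ EF) ?(ltW t0)// /a /b; vector.
  apply: (le_trans (q1D _ _)).
  have := q1D (iter n (F tau) x - x - (n%:R * tau)%:K *: y)
       ((n%:R * tau - (u - s))%:K *: y - a%:K *: (iter n (F tau) y - y)).
  have := real_seminormB (iter n (F tau) (f s - x + a%:K *: y)) (f u - x - b%:K *: y) q1n.
  have := real_seminormB ((n%:R * tau - (u - s))%:K *: y)
    (a%:K *: (iter n (F tau) y - y)) q1n.
  rewrite !real_seminormZ// (ger0_norm a0).
  have := dom2 tau n (f s - x + a%:K *: y) (ltW t0) nT.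
  have := q12 (f u - x - b%:K *: y).
  have : `|n%:R * tau - (u - s)| * q1 y <= tau * q1 y.
    by rewrite ler_wpM2r// ler_norml mus1 mus2.
  have : a * q1 (iter n (F tau) y - y) <= a * (e / 6) by rewrite ler_wpM2l.
  have : tau * (e / 6 + q1 y) <= e / 6 * (u - s) by rewrite -ler_pdivlMr// ltW.
  have : e / 6 * (n%:R * tau) <= e / 6 * (u - s + tau).
    by rewrite ler_pM2l//; lra.
  have : e * (u - s) = e * a + e * b by rewrite /a /b; ring.
  have : 0 <= e * a by rewrite mulr_ge0// ltW.
  have : 0 <= e * b by rewrite mulr_ge0// ltW.
  lra.
have -> : iter m (F tau) (iter (k u tau) (F tau) h - f u) =
    iter (m + n) (F tau) (iter (k s tau) (F tau) h - f s) +
    iter m (F tau) (iter n (F tau) (f s) - f u).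
  rewrite !iterD /k ku iterD !(class_E_iterB EF) ?(ltW t0)//; vector.
apply: (le_trans (qD _ _)).
have := dom1 tau m (iter n (F tau) (f s) - f u) (ltW t0) mT'.
lra.
Qed.


(** The steps are left arbitrary because two choices are needed: multiples of [t] for (a) and (b),
    multiples of the time itself for the final limit. *)
Lemma solution_iterates_cvg (l : R) (h : X) (f : R -> X) (s : R) (tau : nat -> R) :
  local_solution Z l h f -> 0 <= s < l -> (forall n, 0 < tau n) ->
  tau @ \oo --> (0 : R) ->
  (fun n => iter (Num.truncn (s / tau n)) (F (tau n)) h) @ \oo --> f s.
Proof.
move=> sol sl t0 taucvg; apply/(cvg_cseminormP genp) => q qs e e0.
have s1 : 0 < s + 1 by case/andP: sl => s0 _; lra.
have es : 0 < e / (s + 1) by rewrite divr_gt0.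
have [tau0 t00 H] := solution_iterates_le sol sl qs es.
have /cvgrPdistC_lt /(_ _ t00) := taucvg.
apply: filterS => n; rewrite subr0 gtr0_norm// => tn.
apply: (le_lt_trans (H (tau n) _)); first by rewrite t0.
by rewrite mulrAC ltr_pdivrMr// ltr_pM2l//; lra.
Qed.

End Solution.

(** * The completion *)

Lemma real_cauchy_cvg (R : realType) (G : set_system R) : ProperFilter G ->
  (forall e : R, 0 < e -> exists2 A, G A & forall x y, A x -> A y -> `|x - y| < e) ->
  cvg G.
Proof.
move=> FG h; apply: cauchy_cvg; apply: cauchy_exP => e e0.
have [A GA Ae] := h e e0; have [x Ax] := filter_ex GA.
by exists x; apply: filterS GA => y Ay; exact: Ae.
Qed.

Lemma scalars_cauchy_cvg (R : realType) (cplx : bool) (G : set_system (scalars R cplx)) :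
  ProperFilter G ->
  (forall e : R, 0 < e -> exists2 A, G A & forall x y, A x -> A y -> modulus (x - y) < e) ->
  cvg G.
Proof.
case: cplx G => G FG h; last exact: real_cauchy_cvg.
have coord (c : scalars R true -> R) : (forall x y, c (x - y) = c x - c y) ->
    (forall x, `|c x| <= modulus x) -> exists a, forall e : R, 0 < e ->
    \forall x \near G, `|c x - a| < e.
  move=> cB cM; have /cvg_ex[a /cvgrPdistC_lt ca] : cvg (c @ G).
    apply: real_cauchy_cvg => e e0; have [A GA Ae] := h e e0.
    exists (c @` A); first by apply: (@filterS _ G _ A) => // x Ax; exists x.
    move=> _ _ [x Ax <-] [y Ay <-]; rewrite -cB.
    exact: le_lt_trans (cM _) (Ae _ _ Ax Ay).
  by exists a.
have modE (z : scalars R true) :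
    modulus z = Num.sqrt (complex.Re z ^+ 2 + complex.Im z ^+ 2).
  exact: (congr1 (@complex.Re R) (normc_def z)).
have [a ha] : exists a, forall e : R, 0 < e ->
    \forall x \near G, `|complex.Re (x : R[i]) - a| < e.
  apply: (coord (fun z => complex.Re (z : R[i]))) => [[? ?] [? ?]//|x].
  by rewrite modE -sqrtr_sqr ler_wsqrtr// lerDl sqr_ge0.
have [b hb] : exists b, forall e : R, 0 < e ->
    \forall x \near G, `|complex.Im (x : R[i]) - b| < e.
  apply: (coord (fun z => complex.Im (z : R[i]))) => [[? ?] [? ?]//|x].
  by rewrite modE -sqrtr_sqr ler_wsqrtr// lerDr sqr_ge0.
apply/cvg_ex; exists ((a +i* b)%C : scalars R true).
apply/(@cvg_scalarsP R true _ G id) => e e0.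
have e2 : 0 < e / 2 by rewrite divr_gt0.
apply: filterS (filterI (ha _ e2) (hb _ e2)) => -[x y] [/= xa yb].
rewrite -[ltRHS]gtr0_norm// -sqrtr_sqr ltr_sqrt ?exprn_gt0//.
rewrite -(real_normK (num_real (x - a))) -(real_normK (num_real (y - b))).
have := normr_ge0 (x - a); have := normr_ge0 (y - b); nra.
Qed.

Section Completion.
Context (R : realType) (cplx : bool).
Local Notation K := (scalars R cplx).
Context (X : tvsType K) (Omega : Type) (p : Omega -> X -> K).
Context (genp : generating_seminorms p).
Implicit Types (q : X -> R) (phi : X -> K) (G : set_system X).

Lemma cauchy_filterP G : Filter G -> cauchy_filter G <->
  forall q (e : R), cseminorm q -> 0 < e ->
    exists2 A, G A & forall x y, A x -> A y -> q (x - y) < e.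
Proof.
move=> FG; split=> [cG q e qs e0|h].
  have := (cvg_cseminormP genp _ _ _).1 cG q qs e e0.
  move=> [[A B] /= [GA GB] AB]; exists (A `&` B); first exact: filterI.
  by move=> x y [Ax _] [_ By]; have := AB (x, y) (conj Ax By); rewrite /= subr0.
apply/(cvg_cseminormP genp) => q qs e e0; have [A GA Ae] := h q e qs e0.
by exists (A, A) => // -[x y] [/= Ax Ay]; rewrite subr0; exact: Ae.
Qed.

(* Thickening its members turns a Cauchy filter into the minimal Cauchy filter
   below it. *)
Definition thickening G : set_system X :=
  [set A | exists q B, [/\ cseminorm q, G B & forall b x, B b -> q (x - b) < 1 -> A x]].

Lemma thickening_filter G : Filter G -> Filter (thickening G).
Proof.
move=> FG; split.
- exists (fun=> 0), setT; split=> //; [exact: cseminorm_cst0|exact: filterT].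
- move=> A B [q1 [B1 [q1s GB1 h1]]] [q2 [B2 [q2s GB2 h2]]].
  have [[q10 _ _] _] := q1s; have [[q20 _ _] _] := q2s.
  exists (fun x => q1 x + q2 x), (B1 `&` B2); split.
  + exact: cseminorm_add.
  + exact: filterI.
  + move=> b x [b1 b2] lt1; split.
      by apply: (h1 b) => //; apply: le_lt_trans lt1; rewrite lerDl.
    by apply: (h2 b) => //; apply: le_lt_trans lt1; rewrite lerDr.
- move=> A B AB [q [C [qs GC h]]]; exists q, C; split=> // b x Cb x1.
  by apply: AB; exact: (h b).
Qed.

Lemma thickening_le G : Filter G -> thickening G `<=` G.
Proof.
move=> FG A [q [B [[qn _] GB h]]]; apply: filterS GB => b Bb; apply: (h b) => //.
by rewrite subrr real_seminorm0.
Qed.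

Lemma thickening_completion G : ProperFilter G -> cauchy_filter G ->
  completion (thickening G).
Proof.
move=> FG /cauchy_filterP cG; have FT := thickening_filter FG.
split.
- by split=> // /(thickening_le FG)/filter_ex[].
- apply/cauchy_filterP => q e qs e0; have e3 : 0 < e / 3 by rewrite divr_gt0.
  have [A GA Ae] := cG q (e / 3) qs e3.
  exists [set x | exists2 b, A b & q (x - b) < e / 3].
    exists (fun x => (e / 3)^-1 * q x), A; split=> //.
      by apply: cseminorm_scale => //; rewrite invr_ge0 ltW.
    by move=> b x Ab; rewrite ltr_pdivrMl// mulr1 => xb; exists b.
  move=> x y [b Ab xb] [c Ac yc]; have := Ae b c Ab Ac.
  have [qn _] := qs; have [_ qD _] := qn.
  have := qD (x - b) (b - c); have := qD (x - c) (c - y).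
  rewrite !addrA !subrK; have := real_seminormC y c qn; lra.
(* Minimality: a member [C] of [H] of [q]-diameter at most 1 meets [B], hence lies in the unit
   thickening of [B]. *)
- move=> H FH /cauchy_filterP cH HG A [q [B [qs GB h]]].
  have [C HC C1] := cH q 1 qs ltr01.
  have [b [Bb Cb]] := filter_ex (filterI GB (thickening_le FG (HG _ HC))).
  by apply: filterS HC => x Cx; apply: (h b) => //; exact: C1.
Qed.

Lemma thickening_cvg G phi (a : K) : Filter G -> dual_space phi ->
  phi @ G --> a -> phi @ thickening G --> a.
Proof.
move=> FG phid /cvg_scalarsP Ga; have FT := thickening_filter FG.
have [phiL _] := phid.
apply/cvg_scalarsP => e e0; have e2 : 0 < e / 2 by rewrite divr_gt0.
exists (fun x => (e / 2)^-1 * modulus (phi x)), [set x | modulus (phi x - a) < e / 2].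
split.
- by apply: cseminorm_scale; [rewrite invr_ge0 ltW|exact: dual_cseminorm].
- exact: Ga.
- move=> b x /= ba; rewrite ltr_pdivrMl// mulr1 scalarBE// => xb.
  by have := modulusD (phi x - phi b) (phi b - a); rewrite addrA subrK; lra.
Qed.

Lemma completion_extension_thickening G phi (a : K) : ProperFilter G ->
  cauchy_filter G -> dual_space phi -> phi @ G --> a ->
  completion_extension phi (thickening G) = a.
Proof.
move=> FG cG phid Ga; have [FT _ _] := thickening_completion FG cG.
exact: (cvg_lim (@norm_hausdorff _ _) (thickening_cvg FG phid Ga)).
Qed.

Lemma cauchy_filter_nbhs (w : X) : cauchy_filter (nbhs w).
Proof.
apply/cauchy_filterP => q e qs e0; have e2 : 0 < e / 2 by rewrite divr_gt0.
exists [set x | q (x - w) < e / 2]; first exact: (nbhs_ball_cseminorm genp).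
move=> x y /= xw yw; have [qn _] := qs; have [_ qD _] := qn.
have := qD (x - w) (w - y); rewrite addrA subrK (real_seminormC w y)//; lra.
Qed.

(** Both [G] and the neighbourhoods of [w] define points of the completion. Functionals of [A] agree
    at these points, and a pointwise limit of such functionals then agrees there too. *)
Lemma star_dense_cvg (A : set (X -> K)) G (w : X) phi : A `<=` @dual_space R cplx X ->
  star_dense A -> ProperFilter G -> cauchy_filter G ->
  (forall psi, A psi -> psi @ G --> psi w) -> dual_space phi -> phi @ G --> phi w.
Proof.
move=> Ad dA FG cG AG phid; have [phi_ [Aphi cvphi]] := dA _ phid.
have TG := thickening_completion FG cG.
have cw := cauchy_filter_nbhs w.
have cwE psi : dual_space psi -> completion_extension psi (thickening (nbhs w)) = psi w.
  by move=> psid; apply: completion_extension_thickening => //; case: psid => _; exact.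
have := cvphi _ (thickening_completion _ cw); rewrite cwE//.
under eq_fun do rewrite (cwE _ (Ad _ (Aphi _))).
move=> cvw; have := cvphi _ TG.
under eq_fun do
  rewrite (completion_extension_thickening FG cG (Ad _ (Aphi _)) (AG _ (Aphi _))).
move=> cvG; have ext : completion_extension phi (thickening G) = phi w.
  exact: (cvg_unique (@norm_hausdorff _ _) cvG (cvw _)).
have [FT /cauchy_filterP cT _] := TG.
(* The value [lim] carries information only when the limit exists; completeness of the scalars
   provides it. *)
have : cvg (phi @ thickening G).
  apply: scalars_cauchy_cvg => e e0.
  have [B TB Be] := cT (fun x => modulus (phi x)) e (dual_cseminorm phid) e0.
  exists (phi @` B); first by apply: (@filterS _ (thickening G) _ B) => // x Bx; exists x.
  move=> _ _ [x Bx <-] [y By <-]; rewrite -scalarBE; last by case: phid.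
  exact: Be.
rewrite -ext => cvT B nB; apply: (thickening_le FG); exact: cvT.
Qed.

End Completion.

(** * Weak closedness of the graph *)

Lemma real_seminorm_of_le (R : realType) (cplx : bool) (V : lmodType (scalars R cplx))
    (q : V -> R) : (forall x, 0 <= q x) -> (forall x y, q (x + y) <= q x + q y) ->
  (forall a x, q (a *: x) <= modulus a * q x) -> real_seminorm q.
Proof.
move=> q0 qD qZ; split=> // a x; apply/eqP; rewrite eq_le qZ /=.
have [->|a0] := eqVneq a 0; first by rewrite modulus0 mul0r.
have := qZ a^-1 (a *: x); rewrite scalerA mulVf// scale1r.
have ma : modulus a != 0 by apply: contra_neq a0; exact: modulus_eq0.
have -> : modulus a^-1 = (modulus a)^-1.
  apply: (mulfI ma); rewrite -modulusM !mulfV//.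
  by rewrite -(real_scalar1 R cplx) modulus_real normr1.
by rewrite -ler_pdivlMl// lt_def ma modulus_ge0.
Qed.

Section Graph.
Context (R : realType) (cplx : bool).
Local Notation K := (scalars R cplx).
Context (X : tvsType K) (Omega : Type) (p : Omega -> X -> K).
Context (genp : generating_seminorms p).
Context (Z : operator X) (linZ : linear_operator Z).
Implicit Types (q : X -> R).

Definition graph_distances q (v : X * X) : set R :=
  [set q (v.1 - g) + q (v.2 - Z g) | g in dom Z].

Lemma graph_distance_ge0 q v : real_seminorm q -> lbound (graph_distances q v) 0.
Proof. by move=> [q0 _ _] _ [g _ <-]; rewrite addr_ge0. Qed.

Lemma graph_distance_le q v g : real_seminorm q -> dom Z g ->
  inf (graph_distances q v) <= q (v.1 - g) + q (v.2 - Z g).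
Proof.
move=> qn dg; apply: ge_inf; last by exists g.
by exists 0; exact: graph_distance_ge0.
Qed.

(** This is the quotient seminorm modulo a linear subspace: near-optimal graph points for [v] and
    [w] are added, or multiplied by [a], inside the graph. *)
Lemma graph_distance_seminorm q : real_seminorm q ->
  real_seminorm (fun v => inf (graph_distances q v)).
Proof.
move=> qn; have [q0 qD qZ] := qn; have [dom0 domL] := linZ.
have ne v : graph_distances q v !=set0 by exists (q (v.1 - 0) + q (v.2 - Z 0)), 0.
apply: real_seminorm_of_le => [v|v w|a v].
- by apply: lb_le_inf => //; exact: graph_distance_ge0.
- rewrite -lerBlDr; apply: lb_le_inf => // _ [g dg <-].
  rewrite lerBlDr -lerBlDl; apply: lb_le_inf => // _ [k dk <-].
  rewrite lerBlDl; have [dgk Zgk] := domL 1 g k dg dk.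
  rewrite !scale1r in dgk Zgk.
  apply: (le_trans (graph_distance_le (v + w) qn dgk)); rewrite Zgk /= !opprD.
  rewrite addrACA (addrACA v.2) (addrACA (q _)).
  by apply: lerD.
- have Z0 : Z 0 = 0.
    by have [_] := domL (-1) 0 0 dom0 dom0; rewrite scaleN1r oppr0 addr0 scaleN1r addNr.
  have scaled g : dom Z g ->
      inf (graph_distances q (a *: v)) <= modulus a * (q (v.1 - g) + q (v.2 - Z g)).
    move=> dg; have [dag Zag] := domL a g 0 dg dom0.
    rewrite !addr0 Z0 addr0 in dag Zag.
    apply: (le_trans (graph_distance_le _ qn dag)).
    by rewrite Zag /= -!scalerBr !qZ mulrDr.
  have [a0|a0] := eqVneq (modulus a) 0.
    by rewrite a0 mul0r; have := scaled _ dom0; rewrite a0 mul0r.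
  have ap : 0 < modulus a by rewrite lt_def a0 modulus_ge0.
  rewrite -ler_pdivrMl//; apply: lb_le_inf => // _ [g dg <-].
  by rewrite ler_pdivrMl//; exact: scaled.
Qed.

(* The distance to the graph is a seminorm; a Hahn-Banach functional for it
   vanishes on the closure of the graph, hence at weak limits too. *)
Lemma weak_closure_graph (u v : nat -> X) x y :
  (forall n, closure (op_graph Z) (u n, v n)) ->
  weak_cvg u x -> weak_cvg v y -> closure (op_graph Z) (x, y).
Proof.
move=> cl /weak_cvgP ux /weak_cvgP vy; apply/(closure_graphP genp) => q e qs e0.
have [qn _] := qs; have [q0 _ _] := qn; have [dom0 domL] := linZ.
have Z0 : Z 0 = 0.
  by have [_] := domL (-1) 0 0 dom0 dom0; rewrite scaleN1r oppr0 addr0 scaleN1r addNr.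
have dn := graph_distance_seminorm qn.
have [phi [phiL phile phixy]] := hahn_banach (x, y) dn.
have phiE a b : phi (a, b) = phi (a, 0) + phi (0, b).
  by rewrite -scalarDE//; congr (phi (_, _)); rewrite /= ?addr0 ?add0r.
(* The functional on the product splits into two on X, each dominated by [q] through the graph point
   0; weak convergence can then be used in each coordinate. *)
have d1 : dual_space (fun a => phi (a, 0)).
  apply: (cseminorm_dual genp _ qs) => [c a b|a].
    by rewrite -phiL; congr (phi (_, _)); rewrite /= scaler0 addr0.
  apply: (le_trans (phile _)); apply: (le_trans (graph_distance_le _ qn dom0)).
  by rewrite /= Z0 !subr0 (real_seminorm0 qn) addr0.
have d2 : dual_space (fun b => phi (0, b)).
  apply: (cseminorm_dual genp _ qs) => [c a b|a].
    by rewrite -phiL; congr (phi (_, _)); rewrite /= scaler0 addr0.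
  apply: (le_trans (phile _)); apply: (le_trans (graph_distance_le _ qn dom0)).
  by rewrite /= Z0 !subr0 (real_seminorm0 qn) add0r.
have phi0 n : phi (u n, v n) = 0.
  apply: modulus_eq0; apply/eqP; rewrite eq_le modulus_ge0 andbT.
  apply: (le_trans (phile _)); apply/ler_addgt0Pr => r r0; rewrite add0r.
  have r2 : 0 < r / 2 by rewrite divr_gt0.
  have [a [da h1 h2]] := (closure_graphP genp _ _ _).1 (cl n) q (r / 2) qs r2.
  apply: (le_trans (graph_distance_le _ qn da)) => /=.
  rewrite (real_seminormC _ _ qn) (real_seminormC (v n) _ qn); lra.
have cv : (fun n => phi (u n, v n)) @ \oo --> phi (x, y).
  rewrite phiE; under eq_fun do rewrite phiE.
  by apply: cvgD; [exact: (ux _ d1)|exact: (vy _ d2)].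
have xy0 : phi (x, y) = 0.
  have E : (fun n => phi (u n, v n)) = fun=> 0 by apply/funext => n; exact: phi0.
  rewrite E in cv; exact: (cvg_unique (@norm_hausdorff _ _) cv (cvg_cst 0)).
have [] := @inf_adherent _ (graph_distances q (x, y)) e e0.
  split; first by exists (q (x - 0) + q (y - Z 0)), 0.
  by exists 0; exact: graph_distance_ge0.
move=> _ [g dg <-] /=; rewrite -phixy xy0 modulus0 add0r => ge.
exists g; split=> //.
  rewrite (real_seminormC _ _ qn); apply: le_lt_trans ge; rewrite lerDl.
  exact: q0.
rewrite (real_seminormC _ _ qn); apply: le_lt_trans ge; rewrite lerDr.
exact: q0.
Qed.

End Graph.

(** * Weak limits of the iterates *)

Section Diagonal.

Lemma increasing_index_comp (k1 k2 : nat -> nat) :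
  increasing_index k1 -> increasing_index k2 -> increasing_index (k1 \o k2).
Proof. by move=> i1 i2 m n mn; apply/i1/i2. Qed.

Lemma increasing_index_ge (k : nat -> nat) n : increasing_index k -> (n <= k n)%N.
Proof. by move=> ik; elim: n => // n IH; exact: leq_ltn_trans IH (ik _ _ _). Qed.

(* [C j k] is to be read "the j-th sequence converges along the indices k". *)
Lemma diagonal_extraction (C : nat -> (nat -> nat) -> Prop) :
  (forall j k, increasing_index k ->
     exists2 k', increasing_index k' & C j (k \o k')) ->
  (forall j k k' m, C j k -> increasing_index k' ->
     (forall n, (m <= n)%N -> exists2 i, (n <= i)%N & k' n = k i) -> C j k') ->
  exists2 k, increasing_index k & forall j, C j k.
Proof.
move=> extract tail.
pose I := {k : nat -> nat | increasing_index k}.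
have id_incr : increasing_index id by [].
have step (jk : nat * I) : exists k' : I, C jk.1 (sval jk.2 \o sval k').
  have [k' ik' Ck'] := extract jk.1 (sval jk.2) (svalP jk.2).
  by exists (exist _ k' ik').
have [sub subP] := choice step.
pose incr_comp (a b : I) : I := exist _ _ (increasing_index_comp (svalP a) (svalP b)).
pose D := fix D j : I :=
  if j is j'.+1 then incr_comp (D j') (sub (j', D j')) else exist _ id id_incr.
have DS j : sval (D j.+1) = sval (D j) \o sval (sub (j, D j)) by [].
have D_factor i j : (i <= j)%N -> exists2 k, increasing_index k &
    sval (D j) = sval (D i) \o k.
  elim: j => [|j IH]; first by rewrite leqn0 => /eqP->; exists id.
  rewrite leq_eqVlt => /orP[/eqP->|]; first by exists id.
  rewrite ltnS => /IH[k ik Dk]; exists (k \o sval (sub (j, D j))).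
    exact: increasing_index_comp ik (svalP _).
  by rewrite DS Dk.
pose N n := sval (D n) n.
have N_incr : increasing_index N.
  move=> m n mn; have [k ik Dk] := D_factor m n (ltnW mn).
  rewrite /N Dk /=; apply: (svalP (D m)).
  exact: leq_trans mn (increasing_index_ge _ ik).
exists N => // j.
(* [D 0] is the identity, so the sequence [j] is treated on passing from [D j] to [D j.+1]; the
   diagonal is a subsequence of [D j.+1] from the rank [j.+1] on. *)
have CD : C j (sval (D j.+1)) by rewrite DS; exact: (subP (j, D j)).
apply: (tail j _ N j.+1 CD N_incr) => n jn.
have [k ik Dk] := D_factor _ _ jn.
by exists (k n); [exact: increasing_index_ge|rewrite /N Dk].
Qed.

End Diagonal.

(** * Discrete orbits as functions of time *)

Section Orbits.
Context (R : realType) (cplx : bool).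
Local Notation K := (scalars R cplx).
Local Notation "r %:K" := (@real_scalar R cplx r) (at level 2).
Context (X : tvsType K) (Omega : Type) (p : Omega -> X -> K).
Context (genp : generating_seminorms p) (hausX : hausdorff_space X).
Context (F : R -> X -> X) (FF : class_F p F).
Context (tau : nat -> R) (tau_gt0 : forall n, 0 < tau n) (tau_cvg : tau @ \oo --> (0 : R)).
Implicit Types (q : X -> R) (x y : X).

Local Ltac vector := linear_identity_tac genp hausX.
Let EF : class_E p F := FF.1.

Definition discrete_orbit y (s : R) (n : nat) : X :=
  iter (Num.truncn (s / tau n)) (F (tau n)) y.

Lemma near_tau_lt (e : R) : 0 < e -> \forall n \near \oo, tau n < e.
Proof.
move=> e0; have /cvgrPdistC_lt /(_ e e0) := tau_cvg.
by apply: filterS => n; rewrite subr0 gtr0_norm.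
Qed.

Lemma discrete_orbit_dominated (S : R) q : cseminorm q -> 0 <= S ->
  exists q', [/\ cseminorm q', forall x, q x <= q' x &
    forall s n x, 0 <= s <= S -> q (discrete_orbit x s n) <= q' x].
Proof.
move=> qs S0; have [q' [q's qq' dom]] := class_E_dominating genp EF qs S0.
exists q'; split=> // s n x /andP[s0 sS]; apply: dom; first exact: ltW.
exact: le_trans (truncn_mul_le s0 (tau_gt0 n)) sS.
Qed.

(** Taking out the power that reaches the earlier time leaves [F^m y - y] with [m tau n] at most the
    time gap plus [tau n]. The orbit is a step function of time, whence the restriction to large
    [n]. *)
Lemma discrete_orbit_equicontinuous y (S : R) q (e : R) : cseminorm q -> 0 <= S -> 0 < e ->
  exists2 d : R, 0 < d & \forall n \near \oo, forall s u, 0 <= s <= S -> 0 <= u <= S ->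
    `|u - s| < d -> q (discrete_orbit y u n - discrete_orbit y s n) <= e.
Proof.
move=> qs S0 e0; have [qn _] := qs.
have [q' [q's qq' dom]] := discrete_orbit_dominated qs S0.
have [d d0 dP] := strong_continuity genp hausX FF y q's e0.
have d2 : 0 < d / 2 by rewrite divr_gt0.
exists (d / 2) => //; apply: filterS (near_tau_lt d2) => n td s u.
wlog su : s u / s <= u => [H hs hu|/andP[s0 sS] hu].
  have [su|/ltW us] := leP s u; first exact: H.
  by rewrite distrC (real_seminormC _ _ qn); exact: H.
rewrite ger0_norm ?subr_ge0// => usd.
have [ku] := truncn_mulB s0 su (tau_gt0 n); rewrite ler_norml => /andP[_ mu].
rewrite /discrete_orbit ku addnC iterD -(class_E_iterB EF) ?(ltW (tau_gt0 n))//.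
apply: (le_trans (dom s n _ _)); rewrite ?s0//.
apply: dP; first by rewrite tau_gt0 /=; lra.
lra.
Qed.

(** Powers of one operator commute, so the expansion at time 0 is carried to time [s] by the orbit
    itself. The constant [c] also absorbs the rounding of [r] to a multiple of [tau n]. *)
Lemma discrete_orbit_expansion x y (S : R) q (e : R) : approx_derivative F x y ->
  cseminorm q -> 0 <= S -> 0 < e ->
  exists2 d : R, 0 < d & forall c, 0 < c -> \forall n \near \oo,
    forall s r, 0 <= s <= S -> 0 <= s + r <= S -> `|r| < d ->
    q (discrete_orbit x (s + r) n - discrete_orbit x s n - r%:K *: discrete_orbit y s n)
      <= e * `|r| + c.
Proof.
move=> xy qs S0 e0; have [qn _] := qs; have [q0 qD _] := qn.
have e4 : 0 < e / 4 by lra.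
have [q' [q's qq' dom]] := discrete_orbit_dominated qs S0.
have [q'n _] := q's; have [q'0 _ _] := q'n.
have [d1 d10 D1] := iter_expansion genp hausX FF xy q's e4.
have [d2 d20 D2] := discrete_orbit_equicontinuous y qs S0 e4.
pose d := Num.min d1 d2.
have d0 : 0 < d by rewrite lt_min d10 d20.
have [dd1 dd2] : d <= d1 /\ d <= d2 by split; rewrite ge_min lexx ?orbT.
exists (d / 2) => [|c c0]; first by rewrite divr_gt0.
have c2 : 0 < c / 2 by lra.
have [tau0 t00 D3] := D1 _ c2.
have den : 0 < e / 4 + q' y by rewrite ltr_wpDr.
have t2 : 0 < Num.min (Num.min tau0 (d / 2)) (c / 2 / (e / 4 + q' y)).
  by rewrite !lt_min t00 !divr_gt0.
apply: filterS (filterI D2 (near_tau_lt t2)) => n [{}D2 tn] s r.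
move: tn; rewrite !lt_min => /andP[/andP[tt0 td] tc].
have tp := tau_gt0 n.
have fwd s' r' : 0 <= s' <= S -> 0 <= r' -> r' < d / 2 ->
    q (discrete_orbit x (s' + r') n - discrete_orbit x s' n - r'%:K *: discrete_orbit y s' n)
    <= e / 4 * r' + c.
  move=> /andP[s'0 s'S] r'0 r'd.
  have s'r' : s' <= s' + r' by rewrite lerDl.
  have [ku] := truncn_mulB s'0 s'r' tp.
  set m := (Num.truncn ((s' + r') / tau n) - _)%N in ku *.
  rewrite addrAC subrr add0r => mr.
  have [mr1 mr2] : - tau n <= m%:R * tau n - r' /\ m%:R * tau n - r' <= tau n.
    by apply/andP; rewrite -ler_norml.
  have -> : discrete_orbit x (s' + r') n - discrete_orbit x s' n -
      r'%:K *: discrete_orbit y s' n =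
      discrete_orbit (iter m (F (tau n)) x - x - (m%:R * tau n)%:K *: y) s' n +
      (m%:R * tau n - r')%:K *: discrete_orbit y s' n.
    rewrite /discrete_orbit ku addnC iterD !(class_E_iterB EF) ?(ltW tp)//.
    rewrite (class_E_iterZ EF) ?(ltW tp)//; vector.
  apply: (le_trans (qD _ _)); rewrite real_seminormZ//.
  have := dom s' n (iter m (F (tau n)) x - x - (m%:R * tau n)%:K *: y).
  rewrite s'0 s'S => /(_ isT).
  have : q' (iter m (F (tau n)) x - x - (m%:R * tau n)%:K *: y) <=
      e / 4 * (m%:R * tau n) + c / 2 by apply: D3; rewrite ?tp//; lra.
  have : `|m%:R * tau n - r'| * q (discrete_orbit y s' n) <= tau n * q' y.
    by apply: ler_pM => //; apply: dom; rewrite s'0.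
  have : tau n * (e / 4 + q' y) <= c / 2 by rewrite -ler_pdivlMr// ltW.
  have : e / 4 * (m%:R * tau n) <= e / 4 * (r' + tau n) by rewrite ler_pM2l//; lra.
  lra.
move=> hs hsr hr; have [r0|r0] := leP 0 r.
  rewrite ger0_norm// in hr *; apply: (le_trans (fwd _ _ hs r0 hr)).
  by have : 0 <= e * r; [rewrite mulr_ge0// ltW|lra].
rewrite ltr0_norm// in hr *.
have nr0 : 0 <= - r by rewrite oppr_ge0 ltW.
have := fwd _ _ hsr nr0 hr; rewrite addrK => H.
have H2 : q (discrete_orbit y (s + r) n - discrete_orbit y s n) <= e / 4.
  by apply: D2 => //; rewrite addrAC subrr add0r ltr0_norm//; lra.
(* For [r < 0] the forward expansion starts at [s + r], and equicontinuity moves the orbit of [y]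
   from there to [s]. *)
have -> : discrete_orbit x (s + r) n - discrete_orbit x s n - r%:K *: discrete_orbit y s n =
    - ((discrete_orbit x s n - discrete_orbit x (s + r) n -
       (- r)%:K *: discrete_orbit y (s + r) n) +
       r%:K *: (discrete_orbit y s n - discrete_orbit y (s + r) n)) by vector.
rewrite (real_seminormN _ qn); apply: (le_trans (qD _ _)).
rewrite real_seminormZ// ltr0_norm// (real_seminormC (discrete_orbit y s n) _ qn).
have : - r * q (discrete_orbit y (s + r) n - discrete_orbit y s n) <= - r * (e / 4).
  by rewrite ler_wpM2l.
have : 0 <= - r * e by rewrite mulr_ge0// ltW.
lra.
Qed.

Definition adjoint_derivative (psi chi : X -> K) : Prop :=
  [/\ dual_space psi, dual_space chi &
    {family bounded_sets p,
      (fun x => (h^-1)%:K * (adjoint_family F h psi x - adjoint_family F 0 psi x))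
        @[h --> 0^'+] --> chi}].

Lemma adjoint_derivative_bounded psi chi (A : set X) (e : R) :
  adjoint_derivative psi chi -> bounded_sets p A -> 0 < e ->
  exists2 d : R, 0 < d & forall h, 0 < h < d -> forall x, A x ->
    modulus (psi (F h x) - psi x - h%:K * chi x) <= e * h.
Proof.
move=> [_ _ /fam_cvgP der] bA e0.
have eK : 0 < e%:K by rewrite -(real_scalar0 R cplx) ltr_real_scalar.
have U : nbhs (chi : {uniform` A -> K}) [set g | forall x, A x -> `|chi x - g x| < e%:K].
  apply/uniform_nbhs; exists [set ab | `|ab.1 - ab.2| < e%:K]; split=> //.
  by rewrite -entourage_ballE; exists e%:K.
have /near_right0P[d d0 dP] := der _ bA _ U.
exists d => // h hd x Ax; have h0 : 0 < h by case/andP: hd.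
have [_ F0 _] := EF.
have -> : psi (F h x) - psi x - h%:K * chi x =
    h%:K * ((h^-1)%:K * (psi (F h x) - psi x) - chi x).
  by rewrite mulrBr mulrA -real_scalarM mulfV ?gt_eqF// real_scalar1 mul1r.
rewrite modulusM modulus_real gtr0_norm// mulrC ler_pM2r// -modulusN opprB.
apply: ltW; rewrite -(@ltr_real_scalar R cplx) modulusK.
by have := dP _ hd x Ax; rewrite /adjoint_family /= F0.
Qed.

End Orbits.

(** * Functionals in the domain of the adjoint derivative; weak limits of orbits *)

Section Adjoint.
Context (R : realType) (cplx : bool).
Local Notation K := (scalars R cplx).
Local Notation "r %:K" := (@real_scalar R cplx r) (at level 2).
Context (X : tvsType K) (Omega : Type) (p : Omega -> X -> K).
Context (genp : generating_seminorms p) (hausX : hausdorff_space X).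
Context (F : R -> X -> X) (FF : class_F p F).
Context (tau : nat -> R) (tau_gt0 : forall n, 0 < tau n) (tau_cvg : tau @ \oo --> (0 : R)).
Implicit Types (q : X -> R) (x y : X).

Let EF : class_E p F := FF.1.

Lemma cvg_seq_bounded_sets (u : nat -> X) x : u @ \oo --> x -> bounded_sets p (range u).
Proof.
move=> /(cvg_cseminormP genp) ux; apply/(bounded_setsP genp) => q qs.
have [N _ NP] := ux q qs 1 ltr01; have [[q0 qD _] _] := qs.
exists (\sum_(i < N) q (u i) + (1 + q x)) => _ [n _ <-].
have [nN|Nn] := ltnP n N.
  rewrite (bigD1 (Ordinal nN))//= -addrA lerDl addr_ge0//.
    by apply: sumr_ge0 => i _; exact: q0.
  by rewrite addr_ge0.
have := NP n Nn; have := qD (u n - x) x; rewrite subrK /=.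
have : 0 <= \sum_(i < N) q (u i) by apply: sumr_ge0 => i _; exact: q0.
lra.
Qed.

(** The vectors [f_ h] vary with [h], so uniformity over a bounded set is essential. They are
    restricted to the sequence [tau], whose image is bounded: the whole family is bounded near 0 for
    each seminorm, but on an interval that may depend on the seminorm. *)
Lemma adjoint_derivative_mef psi chi x y : adjoint_derivative p F psi chi ->
  mef F x y -> psi y = chi x.
Proof.
move=> ad [f_ [fx fy]]; have [psid chid _] := ad.
have [psiL _] := psid; have [chiL _] := chid; have [_ F0 _] := EF.
have tau_right : tau @ \oo --> 0^'+.
  move=> P /near_right0P[d d0 dP].
  by apply: filterS (near_tau_lt tau_gt0 tau_cvg d0) => n nd; apply: dP; rewrite tau_gt0.
have ux := cvg_comp _ _ tau_right fx.
have vy := cvg_comp _ _ tau_right fy.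
apply/eqP; rewrite -subr_eq0; apply/eqP/modulus_eq0/eqP.
rewrite eq_le modulus_ge0 andbT; apply/ler_addgt0Pr => e e0; rewrite add0r.
have e3 : 0 < e / 3 by rewrite divr_gt0.
have [d d0 dP] := adjoint_derivative_bounded FF ad (cvg_seq_bounded_sets ux) e3.
have /(cvg_cseminormP genp) /(_ _ (dual_cseminorm chid) _ e3) h1 := ux.
move/(cvg_cseminormP genp) : vy => /(_ _ (dual_cseminorm psid) _ e3) h2.
have [n [{}h1 [{}h2 nd]]] := filter_ex (filterI h1 (filterI h2 (near_tau_lt tau_gt0 tau_cvg d0))).
move: h1 h2; rewrite /= F0 /= !scalarBE// scalarZE// scalarBE//.
have un : range (f_ \o tau) (f_ (tau n)) by exists n.
have := dP (tau n) _ _ un; rewrite tau_gt0 nd => /(_ isT).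
have tn0 := tau_gt0 n.
have -> : psi (F (tau n) (f_ (tau n))) - psi (f_ (tau n)) - (tau n)%:K * chi (f_ (tau n)) =
   (tau n)%:K * ((tau n)^-1%:K * (psi (F (tau n) (f_ (tau n))) - psi (f_ (tau n)))
     - chi (f_ (tau n))).
  by rewrite mulrBr mulrA -real_scalarM mulfV ?gt_eqF// real_scalar1 mul1r.
rewrite modulusM modulus_real gtr0_norm// mulrC ler_pM2r//.
set a := _ * (psi _ - _); set b := chi (f_ _) => h3 h1 h2.
have -> : psi y - chi x = (a - b) + (b - chi x) - (a - psi y) by ring.
have := modulusD ((a - b) + (b - chi x)) (- (a - psi y)).
by have := modulusD (a - b) (b - chi x); rewrite modulusN; lra.
Qed.

Lemma adjoint_derivative_closure psi chi (Z : operator X) x y :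
  adjoint_derivative p F psi chi -> (forall f, dom Z f -> mef F f (Z f)) ->
  closure (op_graph Z) (x, y) -> psi y = chi x.
Proof.
move=> ad ZF cl; have [psid chid _] := ad.
apply/eqP; rewrite -subr_eq0; apply/eqP/modulus_eq0/eqP.
rewrite eq_le modulus_ge0 andbT; apply/ler_addgt0Pr => e e0; rewrite add0r.
have e2 : 0 < e / 2 by rewrite divr_gt0.
have [a [da]] := (closure_graphP genp _ _ _).1 cl _ _
  (cseminorm_add (dual_cseminorm psid) (dual_cseminorm chid)) e2.
have [psiL _] := psid; have [chiL _] := chid.
rewrite !scalarBE// (adjoint_derivative_mef ad (ZF a da)).
have := modulus_ge0 (psi a - psi x); have := modulus_ge0 (chi (Z a) - chi y) => h1 h2 h3 h4.
have -> : psi y - chi x = (chi a - chi x) - (chi a - psi y) by ring.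
have := modulusD (chi a - chi x) (- (chi a - psi y)); rewrite modulusN; lra.
Qed.

(** Differentiability is asked of [psi], not of [y]. The one-step formula holds uniformly on the
    bounded set [A] of all iterates up to time [S], and its [m] instances add up because [chi]
    hardly varies along them. *)
Lemma adjoint_orbit_expansion psi chi y (S : R) (e : R) :
  adjoint_derivative p F psi chi -> 0 <= S -> 0 < e ->
  exists2 d : R, 0 < d & forall c, 0 < c -> \forall n \near \oo,
    forall s r, 0 <= s <= S -> 0 <= s + r <= S -> `|r| < d ->
    modulus (psi (discrete_orbit F tau y (s + r) n) - psi (discrete_orbit F tau y s n)
             - r%:K * chi (discrete_orbit F tau y s n)) <= e * `|r| + c.
Proof.
move=> ad S0 e0; have [psid chid _] := ad; have [chiL _] := chid; have [psiL _] := psid.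
have e8 : 0 < e / 8 by lra.
have e4 : 0 < e / 4 by lra.
have chis := dual_cseminorm chid.
have [q' [q's qq' dom]] := class_E_dominating genp EF chis S0.
have [q'n _] := q's; have [q'0 _ _] := q'n.
pose A := [set z | exists (i : nat) (t : R), [/\ 0 < t, i%:R * t <= S & z = iter i (F t) y]].
have bA : bounded_sets p A.
  apply/(bounded_setsP genp) => q qs.
  have [q1 [_ _ dom1]] := class_E_dominating genp EF qs S0.
  by exists (q1 y) => _ [i [t [t0 iS ->]]]; apply: dom1 => //; exact: ltW.
have [d1 d10 D1] := adjoint_derivative_bounded FF ad bA e8.
have [d2 d20 D2] := strong_continuity genp hausX FF y q's e8.
have [d3 d30 D3] := discrete_orbit_equicontinuous genp hausX FF tau_gt0 tau_cvg y chis S0 e4.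
pose d := Num.min (Num.min d1 d2) d3.
have d0 : 0 < d by rewrite !lt_min d10 d20 d30.
have [dd1 dd2 dd3] : [/\ d <= d1, d <= d2 & d <= d3].
  by split; rewrite !ge_min lexx ?orbT.
exists (d / 2) => [|c c0]; first by rewrite divr_gt0.
have den : 0 < e / 4 + q' y by rewrite ltr_wpDr.
have t2 : 0 < Num.min (d / 2) (c / (e / 4 + q' y)) by rewrite lt_min !divr_gt0.
apply: filterS (filterI D3 (near_tau_lt tau_gt0 tau_cvg t2)) => n [{}D3 tn] s r.
move: tn; rewrite lt_min => /andP[td tc]; have tp := tau_gt0 n.
pose orb := discrete_orbit F tau y.
have fwd s' r' : 0 <= s' <= S -> 0 <= s' + r' <= S -> 0 <= r' -> r' < d / 2 ->
    modulus (psi (orb (s' + r') n) - psi (orb s' n) - r'%:K * chi (orb s' n))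
    <= e / 4 * r' + c.
  move=> /andP[s'0 s'S] /andP[sr0 srS] r'0 r'd.
  have s'r' : s' <= s' + r' by rewrite lerDl.
  have [ku] := truncn_mulB s'0 s'r' tp.
  have kS := le_trans (truncn_mul_le sr0 tp) srS; rewrite ku in kS.
  have k0S := le_trans (truncn_mul_le s'0 tp) s'S.
  set m := (Num.truncn ((s' + r') / tau n) - _)%N in ku kS *.
  rewrite addrAC subrr add0r => mr.
  have [mr1 mr2] : - tau n <= m%:R * tau n - r' /\ m%:R * tau n - r' <= tau n.
    by apply/andP; rewrite -ler_norml.
  set k := Num.truncn (s' / tau n) in ku kS k0S.
  set z := orb s' n.
  have step j : (j <= m)%N -> modulus (psi (iter j (F (tau n)) z) - psi z
      - (j%:R * tau n)%:K * chi z) <= e / 4 * (j%:R * tau n).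
    elim: j => [_|j IH jm]; first by rewrite !mul0r real_scalar0 mul0r subr0 subrr modulus0 mulr0.
    have {IH}IH := IH (ltnW jm).
    have jt : j%:R * tau n <= m%:R * tau n by rewrite ler_wpM2r ?(ltW tp)// ler_nat ltnW.
    set w := iter j (F (tau n)) z in IH *.
    have Aw : A w.
      exists (j + k)%N, (tau n); split=> //; last by rewrite iterD.
      apply: le_trans kS; rewrite ler_wpM2r ?(ltW tp)// ler_nat leq_add2r.
      exact: ltnW.
    have h1 : modulus (psi (F (tau n) w) - psi w - (tau n)%:K * chi w) <= e / 8 * tau n.
      by apply: D1 => //; rewrite tp /=; lra.
    have h2 : modulus (chi w - chi z) <= e / 8.
      rewrite -scalarBE// /w /z /orb /discrete_orbit -/k -iterD addnC iterD.
      rewrite -(class_E_iterB EF) ?(ltW tp)//.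
      apply: (le_trans (dom _ _ _ (ltW tp) k0S)); apply: D2; rewrite ?tp/=; lra.
    have -> : psi (iter j.+1 (F (tau n)) z) - psi z - (j.+1%:R * tau n)%:K * chi z =
        (psi w - psi z - (j%:R * tau n)%:K * chi z) +
        ((psi (F (tau n) w) - psi w - (tau n)%:K * chi w) + (tau n)%:K * (chi w - chi z)).
      by rewrite -[j.+1%:R]natr1 mulrDl mul1r real_scalarD iterS -/w; ring.
    apply: (le_trans (modulusD _ _)); rewrite -[j.+1%:R]natr1 mulrDl mul1r mulrDr lerD//.
    apply: (le_trans (modulusD _ _)); rewrite modulusM modulus_real gtr0_norm//.
    by have : tau n * modulus (chi w - chi z) <= tau n * (e / 8); [rewrite ler_pM2l|lra].
  have -> : psi (orb (s' + r') n) - psi z - r'%:K * chi z =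
      (psi (iter m (F (tau n)) z) - psi z - (m%:R * tau n)%:K * chi z) +
      (m%:R * tau n - r')%:K * chi z.
    rewrite {1}/orb /discrete_orbit ku iterD -/(discrete_orbit F tau y s' n) -/z.
    by rewrite real_scalarD real_scalarN; ring.
  apply: (le_trans (modulusD _ _)); rewrite modulusM modulus_real.
  have := step m (leqnn m).
  have : `|m%:R * tau n - r'| * modulus (chi z) <= tau n * q' y.
    by apply: ler_pM => //; [exact: modulus_ge0|apply: dom => //; exact: ltW].
  have : tau n * (e / 4 + q' y) <= c by rewrite -ler_pdivlMr// ltW.
  have : e / 4 * (m%:R * tau n) <= e / 4 * (r' + tau n) by rewrite ler_pM2l//; lra.
  lra.
move=> hs hsr hr; have [r0|r0] := leP 0 r.
  rewrite ger0_norm// in hr *; apply: (le_trans (fwd _ _ hs hsr r0 hr)).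
  by have : 0 <= e * r; [rewrite mulr_ge0// ltW|lra].
rewrite ltr0_norm// in hr *.
have nr0 : 0 <= - r by rewrite oppr_ge0 ltW.
have := fwd (s + r) (- r) hsr; rewrite addrK => /(_ hs nr0 hr) H.
have H2 : modulus (chi (orb (s + r) n) - chi (orb s n)) <= e / 4.
  rewrite -scalarBE//; apply: D3 => //.
  by rewrite addrAC subrr add0r ltr0_norm//; lra.
have -> : psi (orb (s + r) n) - psi (orb s n) - r%:K * chi (orb s n) =
    - (psi (orb s n) - psi (orb (s + r) n) - (- r)%:K * chi (orb (s + r) n)) +
    r%:K * (chi (orb (s + r) n) - chi (orb s n)) by rewrite real_scalarN; ring.
apply: (le_trans (modulusD _ _)); rewrite modulusN modulusM modulus_real ltr0_norm//.
have : - r * modulus (chi (orb (s + r) n) - chi (orb s n)) <= - r * (e / 4).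
  by rewrite ler_wpM2l.
have : 0 <= - r * e by rewrite mulr_ge0// ltW.
lra.
Qed.

(** A diagonal sequence serves all rational times. At any other time the hypothesis supplies a limit
    along a further subsequence, and comparison with a nearby rational time forces the whole
    sequence to that limit. *)
Lemma orbit_weak_subsequence y (l : R) : 0 < l ->
  (forall s, 0 <= s < l -> subsequences_weakly_cvg (discrete_orbit F tau y s)) ->
  exists2 N, increasing_index N & forall s, 0 <= s < l ->
    exists x, weak_cvg (discrete_orbit F tau y s \o N) x.
Proof.
move=> l0 ca.
(* An enumeration of the nonnegative rationals; an index coding no pair counts as [(0, 0)], and
   repetitions are harmless. *)
pose node (j : nat) : R :=
  let ab := odflt (0, 0)%N (unpickle j) in ab.1%:R / ab.2.+1%:R.
pose C j k := node j < l -> exists x, weak_cvg (discrete_orbit F tau y (node j) \o k) x.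
have node0 j : 0 <= node j by rewrite divr_ge0.
have [||N iN CN] := @diagonal_extraction C.
- move=> j k ik; have [jl|jl] := ltP (node j) l; last first.
    by exists id => // hl; move: jl; rewrite leNgt hl.
  have /ca /(_ k ik)[k' [ik' [x hx]]] : 0 <= node j < l by rewrite node0.
  by exists k' => // _; exists x.
- move=> j k k' m Cjk ik' eq jl; have [x /weak_cvgP hx] := Cjk jl; exists x.
  apply/weak_cvgP => phi /hx /cvg_scalarsP cv; apply/cvg_scalarsP => e /cv [M _ MP].
  exists (maxn M m) => // n /=; rewrite geq_max => /andP[Mn mn].
  have [i ni ->] := eq n mn; apply: MP => /=; exact: leq_trans Mn ni.
exists N => // s sl; have /ca /(_ N iN)[k [ik [x hx]]] := sl.
exists x; apply/weak_cvgP => phi phid; apply/cvg_scalarsP => e e0.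
have [phiL _] := phid; have /andP[s0 s_lt] := sl.
have e6 : 0 < e / 6 by lra.
have [d d0 D] := discrete_orbit_equicontinuous genp hausX FF tau_gt0 tau_cvg y
  (dual_cseminorm phid) (ltW l0) e6.
(* Approximating [s] from below keeps the node inside [[0, l)]. *)
have [j [jl js jd]] : exists j, [/\ node j < l, node j <= s & `|node j - s| < d].
  pose b := Num.truncn d^-1; pose a := Num.truncn (s * b.+1%:R).
  have b0 : 0 < b.+1%:R :> R by rewrite ltr0n.
  have bd : d^-1 < b.+1%:R by exact: truncnS_gt.
  have /andP[a1 a2] : a%:R <= s * b.+1%:R < a.+1%:R by apply: truncn_itv; rewrite mulr_ge0// ltW.
  exists (pickle (a, b)); rewrite /node pickleK /=.
  have le : a%:R / b.+1%:R <= s by rewrite ler_pdivrMr.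
  split=> //; first exact: le_lt_trans le s_lt.
  rewrite distrC ger0_norm ?subr_ge0//.
  rewrite -(ltr_pM2r b0) mulrBl divfK ?gt_eqF//.
  apply: (@le_lt_trans _ _ 1); first by rewrite -natr1 in a2; lra.
  by rewrite -ltr_pdivrMl// mulr1.
have [xj /weak_cvgP /(_ _ phid) /cvg_scalarsP /(_ _ e6) hj] := CN j jl.
have /weak_cvgP /(_ _ phid) /cvg_scalarsP /(_ _ e6) hk := hx.
have sS : 0 <= s <= l by rewrite s0 ltW.
have jS : 0 <= node j <= l by rewrite node0 ltW.
have DN : \forall n \near \oo, modulus (phi
    (discrete_orbit F tau y s (N n) - discrete_orbit F tau y (node j) (N n))) <= e / 6.
  have DN' : \forall n \near N @ \oo, modulus (phi
    (discrete_orbit F tau y s n - discrete_orbit F tau y (node j) n)) <= e / 6.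
    apply: (increasing_index_cvg iN); apply: filterS D => n /(_ _ _ jS sS); apply.
    by rewrite distrC.
  exact: DN'.
have both : \forall n \near \oo,
    modulus (phi (discrete_orbit F tau y s (N n)) - phi xj) < e / 3.
  apply: filterS (filterI DN hj) => n [/=]; rewrite scalarBE//.
  set u := phi (_ s _); set v := phi (_ (node j) _) => h1 h2.
  by have := modulusD (u - v) (v - phi xj); rewrite addrA subrK; lra.
have close : modulus (phi xj - phi x) <= e / 2.
  have bothk : \forall n \near \oo,
    modulus (phi (discrete_orbit F tau y s (N (k n))) - phi xj) < e / 3.
    exact: (increasing_index_cvg ik both).
  have [n [h1 h2]] := filter_ex (filterI bothk hk).
  move: h1 h2 => /=; set u := phi (_ s _) => h1 h2.
  have := modulusD (- (u - phi xj)) (u - phi x).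
  by rewrite modulusN opprB addrA subrK; lra.
apply: filterS both => n /=; set u := phi (_ s _) => h.
by have := modulusD (u - phi xj) (phi xj - phi x); rewrite addrA subrK; lra.
Qed.

End Adjoint.

(** * Differentiability of the weak limit *)

Section Existence.
Context (R : realType) (cplx : bool).
Local Notation K := (scalars R cplx).
Local Notation "r %:K" := (@real_scalar R cplx r) (at level 2).
Context (X : tvsType K) (Omega : Type) (p : Omega -> X -> K).
Context (genp : generating_seminorms p) (hausX : hausdorff_space X).
Context (F : R -> X -> X) (FF : class_F p F).
Context (tau : nat -> R) (tau_gt0 : forall n, 0 < tau n) (tau_cvg : tau @ \oo --> (0 : R)).
Implicit Types (q : X -> R) (x y : X).

Local Ltac vector := linear_identity_tac genp hausX.

Lemma cvg_modulus_le (u : nat -> K) (a : K) (c : R) : u @ \oo --> a ->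
  (\forall n \near \oo, modulus (u n) <= c) -> modulus a <= c.
Proof.
move=> /cvg_scalarsP ua uc; apply/ler_addgt0Pr => e e0.
have [n [h1 h2]] := filter_ex (filterI uc (ua e e0)).
by have := modulusD (u n) (- (u n - a)); rewrite modulusN opprB addrC subrK; lra.
Qed.

(** A functional norming [x - w] splits it through a point [y] of the same small set: the Cauchy
    property controls [x - y], the weak limit [y - w]. *)
Lemma cauchy_weak_cvg (G : set_system X) w : ProperFilter G -> cauchy_filter G ->
  (forall phi, dual_space phi -> phi @ G --> phi w) -> G --> w.
Proof.
move=> FG /(cauchy_filterP genp) cG Gw; apply: (cvg_cseminormP genp id w FG).2 => q qs e e0.
have e2 : 0 < e / 2 by rewrite divr_gt0.
have [A GA Ae] := cG q (e / 2) qs e2; apply: (filterS _ GA) => x Ax /=.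
have [phi [phid phiq <-]] := dual_norming genp (x - w) qs; have [phiL _] := phid.
have /cvg_scalarsP /(_ _ e2) hw := Gw _ phid.
have [y [Ay yw]] := filter_ex (filterI GA hw).
have -> : phi (x - w) = phi (x - y) + (phi y - phi w).
  by rewrite !(scalarBE _ _ phiL) addrA subrK.
apply: (le_lt_trans (modulusD _ _)).
by have := phiq (x - y); have := Ae x y Ax Ay; lra.
Qed.

Context (l : R) (x0 y0 : X) (x0y0 : approx_derivative F x0 y0).
Context (N : nat -> nat) (N_incr : increasing_index N) (f : R -> X).
Context (f_lim : forall s, 0 <= s < l ->
  weak_cvg (discrete_orbit F tau x0 s \o N) (f s)).
Context (Z : operator X) (ZF : forall g, dom Z g -> mef F g (Z g)).
Context (dense_adjoint : star_dense (dom_adjoint_derivative p F)).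

Lemma weak_limit_derivative s w : 0 <= s < l -> closure (op_graph Z) (f s, w) ->
  ((d^-1)%:K *: (f (s + d) - f s)) @[d --> within [set d | 0 <= s + d < l] 0^'] --> w.
Proof.
move=> sl fsw; have /andP[s0 s_lt] := sl; have l0 := le_lt_trans s0 s_lt.
set z := fun d => (d^-1)%:K *: (f (s + d) - f s).
set Phi := within _ _.
pose orb := discrete_orbit F tau x0; pose g := discrete_orbit F tau y0 s.
have FPhi : ProperFilter Phi.
  have FPhi : Filter Phi by exact: within_filter.
  split=> // /within_dnbhs0P[r r0 rP].
  pose d := Num.min (r / 2) ((l - s) / 2).
  have d0 : 0 < d by rewrite lt_min !divr_gt0// subr_gt0.
  have [d1 d2] : d <= r / 2 /\ d <= (l - s) / 2 by split; rewrite ge_min lexx ?orbT.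
  apply: (rP d); first by rewrite gt_eqF.
    by rewrite gtr0_norm//; lra.
  by rewrite /=; apply/andP; split; lra.
pose zn d n := (d^-1)%:K *: (orb (s + d) (N n) - orb s (N n)).
have znP d : 0 <= s + d < l -> weak_cvg (zn d) (z d).
  move=> dl; apply: weak_cvgZ; apply: weak_cvgB; exact: f_lim.
have sS : 0 <= s <= l by rewrite s0 ltW.
have inS d : 0 <= s + d < l -> 0 <= s + d <= l by case/andP => -> /ltW ->.
have nearN (P : nat -> Prop) : (\forall n \near \oo, P n) -> \forall n \near \oo, P (N n).
  by move=> nP; exact: (increasing_index_cvg N_incr nP).
have cz : cauchy_filter (z @ Phi).
  apply/(cauchy_filterP genp) => q e qs e0; have [qn _] := qs; have [_ qD _] := qn.
  have e5 : 0 < e / 5 by rewrite divr_gt0.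
  have [r r0 D] := discrete_orbit_expansion genp hausX FF tau_gt0 tau_cvg x0y0 qs (ltW l0) e5.
  exists (z @` [set d | [/\ d != 0, `|d| < r & 0 <= s + d < l]]).
    apply/within_dnbhs0P; exists r => // d d0 dr dl; exists d => //.
  move=> _ _ [d [d0 dr dl] <-] [d' [d'0 d'r d'l] <-].
  have est b : b != 0 -> `|b| < r -> 0 <= s + b < l ->
      \forall n \near \oo, q (zn b n - g (N n)) <= 2 * (e / 5).
    (* With [b] fixed while [n] grows, [c] may depend on [b]; this choice survives the division by
       [b]. *)
    move=> b0 br bl; have c0 : 0 < e / 5 * `|b| by rewrite mulr_gt0// normr_gt0.
    apply: filterS (nearN _ (D _ c0)) => n /(_ s b sS (inS _ bl) br).
    have -> : zn b n - g (N n) =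
        (b^-1)%:K *: (orb (s + b) (N n) - orb s (N n) - b%:K *: g (N n)).
      by rewrite [in RHS]scalerBr scalerA -real_scalarM mulVf// real_scalar1 scale1r.
    rewrite real_seminormZ// normfV ler_pdivrMl ?normr_gt0//; lra.
  apply: (@le_lt_trans _ _ (4 * (e / 5))); last by lra.
  apply: (weak_cvg_seminorm_le genp (weak_cvgB (znP _ dl) (znP _ d'l)) qs).
  apply: filterS (filterI (est _ d0 dr dl) (est _ d'0 d'r d'l)) => n [h1 h2].
  (* No convergence of [g] is known; it only acts as a common centre and cancels. *)
  have -> : zn d n - zn d' n = (zn d n - g (N n)) - (zn d' n - g (N n)).
    by rewrite opprB addrA subrK.
  have := real_seminormB (zn d n - g (N n)) (zn d' n - g (N n)) qn; lra.
apply: cauchy_weak_cvg => // phi phid.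
apply: (star_dense_cvg genp _ dense_adjoint _ cz _ phid) => [psi []//|psi [psid [chi chid der]]].
have ad : adjoint_derivative p F psi chi by split.
have [psiL _] := psid.
rewrite (adjoint_derivative_closure genp FF tau_gt0 tau_cvg ad ZF fsw).
apply/cvg_scalarsP => e e0; have e3 : 0 < e / 3 by rewrite divr_gt0.
have [r r0 D] := adjoint_orbit_expansion genp hausX FF tau_gt0 tau_cvg x0 ad (ltW l0) e3.
apply/within_dnbhs0P; exists r => // d d0 dr dl /=.
apply: (@le_lt_trans _ _ (2 * (e / 3))); last by lra.
apply: (@cvg_modulus_le (fun n => psi (zn d n) - chi (orb s (N n)))).
  have /weak_cvgP /(_ _ psid) h1 := znP _ dl.
  have /weak_cvgP /(_ _ chid) h2 := f_lim sl.
  exact: cvgB h1 h2.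
have c0 : 0 < e / 3 * `|d| by rewrite mulr_gt0// normr_gt0.
apply: filterS (nearN _ (D _ c0)) => n /(_ s d sS (inS _ dl) dr).
have -> : psi (zn d n) - chi (orb s (N n)) =
    (d^-1)%:K * (psi (orb (s + d) (N n)) - psi (orb s (N n)) - d%:K * chi (orb s (N n))).
  rewrite /zn scalarZE// scalarBE// [in RHS]mulrBr mulrA -real_scalarM mulVf//.
  by rewrite real_scalar1 mul1r.
rewrite modulusM modulus_real normfV ler_pdivrMl ?normr_gt0//; lra.
Qed.

End Existence.

(** * The equivalence and the limit formula *)

Lemma chernoff_iteratesE (R : realType) (X : Type) (F : R -> X -> X) (t s : R) (h : X) :
  0 < t -> chernoff_iterates F t s h =
  fun n => iter (Num.truncn (s / (t / n.+1%:R))) (F (t / n.+1%:R)) h.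
Proof.
move=> t0; apply/funext => n; rewrite /chernoff_iterates; congr (iter (Num.truncn _) _ _).
by field; rewrite gt_eqF// gt_eqF// ltr0n.
Qed.

Lemma divn_step_cvg (R : realType) (t : R) : (fun n => t / n.+1%:R) @ \oo --> (0 : R).
Proof.
rewrite -[X in _ --> X](mulr0 t).
by apply: cvgMl_tmp; exact: cvg_harmonic.
Qed.

Theorem theorem7p1 (R : realType) (cplx : bool) (X : tvsType (scalars R cplx))
    (Omega : Type) (p : Omega -> X -> scalars R cplx)
    (hausdorffX : hausdorff_space X) (genp : generating_seminorms p)
    (Z : operator X) (ZX : class_Z p Z) (t : R) (t0 : 0 < t)
    (F : R -> X -> X) (FX : class_F p F)
    (condi : dom Z `<=` dom (effective_derivative F) /\
             forall g, dom Z g -> effective_derivative F g = Z g)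
    (condii : star_dense (dom_adjoint_derivative p F))
    (l : R) (l0 : 0 < l) (h : X) (hZ : dom Z h) :
  let condition_a :=
    forall s : R, 0 <= s < l -> subsequences_weakly_cvg (chernoff_iterates F t s h) in
  let condition_b :=
    forall s : R, 0 <= s < l ->
      exists f_ : nat -> X,
        [/\ forall n, dom (closure_operator Z) (f_ n),
            weak_cvg (fun n => chernoff_iterates F t s h n - f_ n) 0
          & subsequences_weakly_cvg (fun n => closure_operator Z (f_ n))] in
  ((exists f : R -> X, local_solution Z l h f) <-> condition_a /\ condition_b) /\
  (condition_a /\ condition_b ->
    forall f : R -> X, local_solution Z l h f ->
      forall v : R, 0 <= v < l -> iter n (F (v / n%:R)) h @[n --> \oo] --> f v).
Proof.
move=> condition_a condition_b.
have [linZ _ _] := ZX; have [domF eqF] := condi; have [EF _] := FX.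
have ZF g : dom Z g -> mef F g (Z g).
  by move=> dg; rewrite -(eqF g dg); exact: xgetPex (domF g dg).
pose tau n : R := t / n.+1%:R.
have tau_gt0 n : 0 < tau n by rewrite divr_gt0// ltr0n.
have tau_cvg : tau @ \oo --> (0 : R) by exact: divn_step_cvg.
have iterE s : chernoff_iterates F t s h = discrete_orbit F tau h s.
  exact: chernoff_iteratesE.
split; first split=> [[f sol]|[ca cb]].
- have cv s : 0 <= s < l -> chernoff_iterates F t s h @ \oo --> f s.
    move=> sl; rewrite iterE.
    exact: (solution_iterates_cvg genp hausdorffX FX ZF sol sl tau_gt0 tau_cvg).
  have [fdom _ _] := sol.
  split=> [s /cv|s sl]; first exact: cvg_subsequences_weakly_cvg.
  exists (fun=> f s); split=> [n||].
  + exact: fdom.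
  + rewrite -(subrr (f s)); apply: weak_cvgB; apply: cvg_weak_cvg; first exact: cv.
    exact: cvg_cst.
  + apply: cvg_subsequences_weakly_cvg; exact: cvg_cst.
- have ca' s : 0 <= s < l -> subsequences_weakly_cvg (discrete_orbit F tau h s).
    by move=> /ca; rewrite iterE.
  have [N iN hN] := orbit_weak_subsequence genp hausdorffX FX tau_gt0 tau_cvg l0 ca'.
  have /choice[f fP] : forall s, exists x, 0 <= s < l ->
      weak_cvg (discrete_orbit F tau h s \o N) x.
    move=> s; have [/hN[x hx]|ns] := boolP (0 <= s < l); first by exists x.
    by exists 0.
  have f0 : f 0 = h.
    have sl : 0 <= (0 : R) < l by rewrite lexx.
    apply: (weak_cvg_unique genp hausdorffX (fP 0 sl)).
    apply: cvg_weak_cvg; rewrite (_ : _ \o _ = fun=> h); first exact: cvg_cst.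
    by apply/funext => n /=; rewrite /discrete_orbit mul0r truncn0.
  have fdom s : 0 <= s < l -> dom (closure_operator Z) (f s).
    move=> sl; have [f_ [f_dom f_cvg f_sub]] := cb s sl.
    (* Condition (b) is used along [N], where the iterates already converge to [f s]; the [f_]
       differ from them by a weakly null sequence, so they have the same weak limit. *)
    have [k [ik [y hy]]] := f_sub N iN; exists y.
    apply: (weak_closure_graph genp linZ (u := f_ \o N \o k) _ _ hy) => [n|].
      exact: closure_operatorP (f_dom _).
    have := weak_cvgB (weak_cvg_subseq ik (fP s sl))
      (weak_cvg_subseq (increasing_index_comp iN ik) f_cvg).
    rewrite subr0 iterE; congr (weak_cvg _ _); apply/funext => n /=.
    by rewrite opprB addrC subrK.
  exists f; split=> // s sl.
exact: (weak_limit_derivative genp hausdorffX FX tau_gt0 tau_cvg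
    (mef_approx_derivative genp FX (ZF h hZ)) iN fP ZF condii sl
    (closure_operatorP (fdom s sl))).
move=> _ f sol v vl; have /andP[v0 _] := vl.
have [_ f0 _] := sol.
move: v0; rewrite le_eqVlt => /orP[/eqP v0|v0].
  rewrite -v0 f0 (_ : (fun n => _) = fun=> h); first exact: cvg_cst.
  have [_ F0 _] := EF.
  by apply/funext => n; rewrite mul0r F0; elim: n.
have step0 n : 0 < v / n.+1%:R by rewrite divr_gt0// ltr0n.
have cv := solution_iterates_cvg genp hausdorffX FX ZF sol vl step0 (@divn_step_cvg R v).
(* [cv] gives the number [n] to the step [v / n.+1], so its rank is shifted by one and the term of
   index 0 discarded; the number of iterations [v / (v / n.+1)] is exactly [n.+1]. *)
move=> A /cv[M _ MA]; exists M.+1 => // -[//|n] /= Mn; have := MA n Mn.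
by rewrite /= invf_div mulrC divfK ?gt_eqF// natrK.
Qed.
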